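(* Let $a_0,a_1,c_0,c_1$ be non-negative integers, $a=a_0+a_1$, $c=c_0+c_1$. Let $\beta\in\binom{[a]}{a_1}$, $\gamma,\delta\in\binom{[c]}{c_1}$ and $\nu\in\binom{[a+c]}{a_1+c_1}$. Then the number $\mathrm{Trap}(\beta,\gamma,\nu,\delta)$ of trapezoidal puzzles with SW, NW, NE, South labels $\beta,\gamma,\nu,\delta$ is $$\mathrm{Trap}(\beta,\gamma,\nu,\delta)=\sum_{\mu}c_{(\beta^\vee)^!,\mu^!}^{\nu}\cdot c_{\gamma,\mu}^{\delta^\vee},$$ where the sum is over $\mu\in\binom{[c]}{c_1}$.
   Context: Strings: $\binom{[n]}{k}$ denotes the set of binary strings (words in $0,1$) of length $n$ with exactly $k$ ones; $\lambda^\vee$ is the reversal of $\lambda$. Littlewood-Richardson numbers: for $\lambda,\mu,\nu\in\binom{[n]}{k}$, $c_{\lambda,\mu}^\nu$ is defined by $[X_\lambda][X_\mu]=\sum_{\nu\in\binom{[n]}{k}}c_{\lambda,\mu}^\nu[X_\nu]$ in $H^*(\mathrm{Gr}(k;\mathbb{C}^n))$, where $X_\lambda=\{V:\dim(V\cap\langle e_1,\dots,e_i\rangle)\ge\lambda_1+\dots+\lambda_i\ \forall i\}$ is a Schubert variety. Equivalently it is the usual Littlewood-Richardson coefficient of the partitions attached to the strings, the partition of $\lambda$ having as its $j$-th part the number of $0$s to the right of the $j$-th $1$ in $\lambda$. Padding: if $\nu$ has $n_0$ zeros and $n_1$ ones, $\lambda$ has $l_0\le n_0$ zeros and $l_1\le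 n_1$ ones, and $\mu$ has $m_0\le n_0$ zeros and $m_1\le n_1$ ones, then $c_{\lambda^!,\mu^!}^\nu:=c_{0^{n_0-l_0}\lambda1^{n_1-l_1},\,0^{n_0-m_0}\mu1^{n_1-m_1}}^\nu$ (juxtaposition is concatenation). Puzzles: work in the triangular lattice in the plane, whose unit edges make angles $0^\circ,60^\circ,120^\circ$ with the $x$-axis. Edge labels are the three symbols $0$, $1$, $10$ (where $10$ is a single symbol). A unit triangle (upward- or downward-pointing) with labeled edges is an allowed piece if its three labels read clockwise are $(0,0,0)$, $(1,1,1)$, or a cyclic rotation of $(1,0,10)$. Given a convex lattice polygon (sides along lattice directions, some sides possibly of length $0$) each of whose sides is labeled by a binary string, one symbol per unit edge, read clockwise around the polygon, a puzzle with this boundary is an assignment of labels to all unit lattice edges in the polygon which agrees with the prescribed labels on the boundary and for which every unit triangle in the polygon is an allowed piece. $\mathrm{Trap}(\beta,\gamma,\nu,\delta)$ is the number of puzzles on the trapezoid with sides, in clockwise order, SW (length $a$), NW (length $c$), NE (the long base, length $a+c$, parallel to the SW side) and South (length $c$), labeled respectively $\beta,\gamma,\nu,\delta$, each read clockwise. *)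

(* Defs.v *)
From HB Require Import structures.
From mathcomp Require Import all_boot all_order all_algebra.
From mathcomp Require Import fraction mpoly.
From Stdlib Require ClassicalEpsilon.

Set Implicit Arguments.
Unset Strict Implicit.
Unset Printing Implicit Defensive.

Import GRing.Theory.
Local Open Scope ring_scope.

(** * Littlewood-Richardson coefficients

  The coefficient [LR lam mu nu] is the structure constant of Schur
  polynomials in k variables, s_lam * s_mu = \sum_nu c_{lam,mu}^nu s_nu.
  A partition with at most k parts is a non-increasing exponent vector in
  ['X_{1..k}]. *)

Section Schur.
Variable k : nat.

Definition is_partition (lam : 'X_{1..k}) : bool :=
  [forall i : 'I_k, forall j : 'I_k, (i <= j)%N ==> (lam j <= lam i)%N].

Definition alternant (alpha : 'X_{1..k}) : {mpoly int[k]} :=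
  \det (\matrix_(i < k, j < k) 'X_i ^+ alpha j).

Definition staircase : 'X_{1..k} := [multinom (k - i.+1)%N | i < k].

(* Jacobi's bialternant formula; the quotient, taken in the fraction field, is
   a polynomial when lam is a partition. *)
Definition schur (lam : 'X_{1..k}) : {fraction {mpoly int[k]}} :=
  tofrac (alternant (lam + staircase)%MM) / tofrac (alternant staircase).

(* [c] is finitely supported on partitions, and f = \sum_nu c nu * s_nu.  Schur
   polynomials being linearly independent, there is at most one such [c]. *)
Definition schur_expansion (f : {fraction {mpoly int[k]}})
    (c : 'X_{1..k} -> int) : Prop :=
  exists N : nat,
    (forall nu, c nu != 0 -> is_partition nu && (mdeg nu < N)%N) /\
    f = \sum_(nu : 'X_{1..k < N} | is_partition nu) (c nu)%:~R * schur nu.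

Definition LR (lam mu : 'X_{1..k}) : 'X_{1..k} -> int :=
  ClassicalEpsilon.epsilon (inhabits (fun _ => 0))
    (schur_expansion (schur lam * schur mu)).

End Schur.

(** * Binary strings: [false] is the letter 0 and [true] is the letter 1. *)

Definition zeros (s : seq bool) : nat := count_mem false s.
Definition ones (s : seq bool) : nat := count_mem true s.

Definition strings (n k : nat) : {set n.-tuple bool} :=
  [set s : n.-tuple bool | ones s == k].

(* The j-th part is the number of 0s to the right of the j-th 1. *)
Fixpoint parts (s : seq bool) : seq nat :=
  if s is b :: s' then if b then zeros s' :: parts s' else parts s' else [::].

Definition partition_of (k : nat) (s : seq bool) : 'X_{1..k} :=
  [multinom nth 0%N (parts s) i | i < k].

(* Meant for three strings with the same numbers of 0s and of 1s. *)
Definition LR_string (lam mu nu : seq bool) : int :=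
  LR (partition_of (ones nu) lam) (partition_of (ones nu) mu)
     (partition_of (ones nu) nu).

Definition pad (n0 n1 : nat) (s : seq bool) : seq bool :=
  nseq (n0 - zeros s) false ++ s ++ nseq (n1 - ones s) true.

(* The coefficient c_{lam^!, mu^!}^nu. *)
Definition LR_pad (lam mu nu : seq bool) : int :=
  LR_string (pad (zeros nu) (ones nu) lam) (pad (zeros nu) (ones nu) mu) nu.

(** * Puzzles *)

Variant label := L0 | L1 | L10.

Definition option_of_label (l : label) : option bool :=
  match l with L0 => Some false | L1 => Some true | L10 => None end.
Definition label_of_option (o : option bool) : label :=
  match o with Some false => L0 | Some true => L1 | None => L10 end.
Lemma option_of_labelK : cancel option_of_label label_of_option.
Proof. by case. Qed.
HB.instance Definition _ := Finite.copy label (can_type option_of_labelK).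

Definition label_of_bool (b : bool) : label := if b then L1 else L0.

Variant dir := E0 | E60 | E120.

Definition option_of_dir (d : dir) : option bool :=
  match d with E0 => Some false | E60 => Some true | E120 => None end.
Definition dir_of_option (o : option bool) : dir :=
  match o with Some false => E0 | Some true => E60 | None => E120 end.
Lemma option_of_dirK : cancel option_of_dir dir_of_option.
Proof. by case. Qed.
HB.instance Definition _ := Finite.copy dir (can_type option_of_dirK).

(* (x, y) is the lattice point x u + y v, with u and v the unit vectors at
   angles 0 and 60 degrees from the x-axis. *)
Definition point : Type := (nat * nat)%type.

(* [(d, p)] is the edge of direction d of the upward triangle whose lower left
   corner is p. *)
Definition edge : Type := (dir * point)%type.

Definition edge_ends (e : edge) : seq point :=
  let: (d, (x, y)) := e in
  match d with
  | E0 => [:: (x, y); (x.+1, y)]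
  | E60 => [:: (x, y); (x, y.+1)]
  | E120 => [:: (x.+1, y); (x, y.+1)]
  end.

(* The upward triangle with corners (x, y), (x, y+1), (x+1, y), and the downward
   triangle with corners (x, y+1), (x+1, y+1), (x+1, y): the lists of their
   corners, and of their edges read clockwise. *)
Definition up_corners (p : point) : seq point :=
  let: (x, y) := p in [:: (x, y); (x, y.+1); (x.+1, y)].
Definition up_edges (p : point) : seq edge :=
  [:: (E60, p); (E120, p); (E0, p)].
Definition down_corners (p : point) : seq point :=
  let: (x, y) := p in [:: (x, y.+1); (x.+1, y.+1); (x.+1, y)].
Definition down_edges (p : point) : seq edge :=
  let: (x, y) := p in [:: (E0, (x, y.+1)); (E60, (x.+1, y)); (E120, (x, y))].

Definition allowed_pieces : seq (seq label) :=
  [:: [:: L0; L0; L0]; [:: L1; L1; L1];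
      [:: L1; L0; L10]; [:: L0; L10; L1]; [:: L10; L1; L0]].

Section Trapezoid.
Variables a c : nat.

(* The trapezoid has corners (a, 0), (0, a), (0, a + c) and (a + c, 0). *)
Definition in_trap (p : point) : bool := (a <= p.1 + p.2 <= a + c)%N.

Definition grid : seq point :=
  [seq (x, y) | x <- iota 0 (a + c).+1, y <- iota 0 (a + c).+1].

Definition trap_edges : seq edge :=
  [seq e <- [seq (d, p) | d <- [:: E0; E60; E120], p <- grid]
         | all in_trap (edge_ends e)].

Definition labeling : Type := {ffun seq_sub trap_edges -> label}.

(* The successive edges in [es] all belong to the trapezoid and carry the
   successive labels in [w]. *)
Definition reads (L : labeling) (es : seq edge) (w : seq label) : bool :=
  [seq omap L (insub e) | e <- es] == [seq Some l | l <- w].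

Definition allowed (L : labeling) (t : seq edge) : bool :=
  has (reads L t) allowed_pieces.

(* The edges of the four sides, in clockwise order around the trapezoid. *)
Definition side_SW : seq edge := mkseq (fun i => (E120, (a - i.+1, i)%N)) a.
Definition side_NW : seq edge := mkseq (fun i => (E60, (0, a + i)%N)) c.
Definition side_NE : seq edge :=
  mkseq (fun i => (E120, (i, a + c - i.+1)%N)) (a + c).
Definition side_S : seq edge := mkseq (fun i => (E0, (a + c - i.+1, 0)%N)) c.

Definition reads_string (L : labeling) (es : seq edge) (w : seq bool) : bool :=
  reads L es [seq label_of_bool b | b <- w].

Definition is_puzzle (beta gamma nu delta : seq bool) (L : labeling) : bool :=
  [&& reads_string L side_SW beta, reads_string L side_NW gamma,
      reads_string L side_NE nu, reads_string L side_S delta,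
      all (fun p => all in_trap (up_corners p) ==> allowed L (up_edges p)) grid
    & all (fun p => all in_trap (down_corners p) ==> allowed L (down_edges p))
        grid].

Definition Trap (beta : a.-tuple bool) (gamma : c.-tuple bool)
    (nu : (a + c).-tuple bool) (delta : c.-tuple bool) : nat :=
  #|[set L : labeling | is_puzzle beta gamma nu delta L]|.

End Trapezoid.

(* Main.v *)
(* A puzzle is cut into strips parallel to the base, so that Trap becomes the
   number Tr of ways to transfer the word of the SW side to that of the NE side.
   Moving a word's letters 1 one step to the left adds a vertical strip to its
   partition. An auxiliary line obeying Yang-Baxter equations with the puzzle
   pieces, moved across the trapezoid, shows that adding a vertical strip to nu
   amounts to removing a vertical strip from beta and adding one to gamma, with
   sizes summing to the given one.

   These relations determine Tr. A nontrivial word is the leading term of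
   the sum of all words obtained from a smaller one by adding a vertical strip of
   a suitable size, so that induction reduces nu to the empty partition, where
   Tr is a Kronecker delta. For beta empty the relations are the Pieri rule, so
   triangular puzzles compute Littlewood-Richardson coefficients. The
   right-hand side of the theorem obeys the same relations, by the Pieri rule and
   the Leibniz rule for removing vertical strips from a product; the latter
   follows, by the same induction, from the commutation of adding and removing
   vertical strips. The last two facts are only proved for partitions that are
   small with respect to the box, which suffices since padding all words does not
   change either side. *)

Require Import Defs.
From HB Require Import structures.
From mathcomp Require Import all_boot all_order all_algebra.
From mathcomp Require Import fingroup perm fraction mpoly.
From mathcomp Require Import zify ring.
From Stdlib Require ClassicalEpsilon FunctionalExtensionality.

Set Implicit Arguments.
Unset Strict Implicit.
Unset Printing Implicit Defensive.

Import GRing.Theory.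
Local Open Scope ring_scope.

(** * Transfer by strips *)

(** The relations for [Tr] hold in every box, whereas the two facts about the right-hand side feel
    that words are finite. Pieri's rule needs a leading 0, since otherwise the largest part has no
    room to grow. For symmetric functions, let E(q) be multiplication by the sum of the e_r q^r and
    E^perp(1) the sum of the operators adjoint to the e_r; then E(q) E^perp(1) = (1 - q) E^perp(1)
    E(q), because every <e_r, e_r> is 1. On words this survives only modulo q^m, m being the number
    of letters 1 at the end of both words, that is, of zero parts that can still grow. Hence one
    bound in terms of the number of 0s and one in terms of the number of 1s; padding with 0s in
    front and 1s at the end raises both numbers without changing the partition.

    In the induction on words, the vertical strip that is removed is the whole first column: the
    last 0 of the word goes to the front. Since [Tr] and the right-hand side are homogeneous in the
    sizes of the partitions, the Leibniz rule is needed only in total, not for each strip size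
    separately. *)

Definition tri (x y z : label) : bool := [:: x; y; z] \in allowed_pieces.

Definition labels : seq label := [:: L0; L1; L10].

(* A strip lies between two consecutive lines x + y = m and x + y = m + 1.
   [stripl g w d] lists the words that can be read on the outer line when w is
   read on the inner one and g, d are the labels of the two end edges;
   [trapl] stacks strips. *)
Definition ups (g s : label) : seq label := [seq o <- labels | tri g o s].
Definition downs (i : label) : seq (label * label) :=
  [seq st <- [seq (s, t) | s <- labels, t <- labels] | tri st.1 st.2 i].

Fixpoint stripl (g : label) (w : seq label) (d : label) : seq (seq label) :=
  if w is i :: w' then
    [seq r.1 :: r.2 | st <- downs i,
       r <- [seq (o, x) | o <- ups g st.1, x <- stripl st.2 w' d]]
  else [seq [:: o] | o <- ups g d].

Fixpoint trapl (w gamma delta : seq label) : seq (seq label) :=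
  match gamma, delta with
  | g :: gamma', d :: delta' =>
      flatten [seq trapl w' gamma' delta' | w' <- stripl g w d]
  | _, _ => [:: w]
  end.

Lemma big_stripl_nil (M : nmodType) g d (K : seq label -> M) :
  \sum_(x <- stripl g [::] d) K x = \sum_(o <- ups g d) K [:: o].
Proof. by rewrite /= big_map. Qed.

Lemma big_stripl_cons (M : nmodType) g i w d (K : seq label -> M) :
  \sum_(x <- stripl g (i :: w) d) K x =
  \sum_(st <- downs i) \sum_(o <- ups g st.1)
    \sum_(x <- stripl st.2 w d) K (o :: x).
Proof.
rewrite /= big_allpairs_dep; apply: eq_bigr => st _.
by rewrite big_allpairs_dep.
Qed.

Lemma big_trapl_cons (M : nmodType) w g gamma d delta (K : seq label -> M) :
  \sum_(x <- trapl w (g :: gamma) (d :: delta)) K x =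
  \sum_(w' <- stripl g w d) \sum_(x <- trapl w' gamma delta) K x.
Proof. by rewrite /= big_flatten big_map. Qed.

(** * Moving an auxiliary line across a strip and across a trapezoid *)

Section Lines.
Variable R : comNzRingType.
Variable aux : Type.

Definition crossing := aux -> label -> seq (R * (aux * label)).

Definition cross (W : crossing) a x (K : aux -> label -> R) : R :=
  \sum_(p <- W a x) p.1 * K p.2.1 p.2.2.

Fixpoint linel (W : crossing) (a : aux) (w : seq label)
    : seq (R * (aux * seq label)) :=
  if w is x :: w' then
    [seq (p.1 * q.1, (q.2.1, p.2.2 :: q.2.2)) | p <- W a x,
       q <- linel W p.2.1 w']
  else [:: (1, (a, [::]))].

Definition line (W : crossing) a w (K : aux -> seq label -> R) : R :=
  \sum_(q <- linel W a w) q.1 * K q.2.1 q.2.2.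

Lemma line_nil W a K : line W a [::] K = K a [::].
Proof. by rewrite /line big_seq1 mul1r. Qed.

Lemma line_cons W a x w K :
  line W a (x :: w) K =
  cross W a x (fun b y => line W b w (fun c v => K c (y :: v))).
Proof.
rewrite /line /cross /= big_allpairs_dep; apply: eq_bigr => p _.
by rewrite big_distrr; apply: eq_bigr => q _; rewrite /= mulrA.
Qed.

Lemma eq_cross W a x K K' : (forall b y, K b y = K' b y) ->
  cross W a x K = cross W a x K'.
Proof. by move=> e; apply: eq_bigr => p _; rewrite e. Qed.

Lemma eq_line W a w K K' : (forall b v, K b v = K' b v) ->
  line W a w K = line W a w K'.
Proof. by move=> e; apply: eq_bigr => p _; rewrite e. Qed.

Lemma cross_sum W a x (I : Type) (r : seq I) K :
  cross W a x (fun b y => \sum_(i <- r) K i b y) =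
  \sum_(i <- r) cross W a x (K i).
Proof.
rewrite /cross exchange_big /=; apply: eq_bigr => p _.
by rewrite big_distrr.
Qed.

Lemma line_sum W a w (I : Type) (r : seq I) K :
  line W a w (fun b y => \sum_(i <- r) K i b y) =
  \sum_(i <- r) line W a w (K i).
Proof.
rewrite /line exchange_big /=; apply: eq_bigr => p _.
by rewrite big_distrr.
Qed.

Lemma line_rcons W a w x K :
  line W a (rcons w x) K =
  line W a w (fun b v => cross W b x (fun c y => K c (rcons v y))).
Proof.
elim: w a K => [|y w IHw] a K.
  rewrite line_nil line_cons; apply: eq_cross => b y; exact: line_nil.
by rewrite rcons_cons !line_cons; apply: eq_cross => b z; rewrite IHw.
Qed.

(* Yang-Baxter equations: an auxiliary line can be moved across an upward and
   across a downward triangle. *)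
Variables W60 W120 W0 : crossing.

Hypothesis upE : forall a g s (K : aux -> label -> R),
  cross W60 a g (fun b g' => cross W0 b s (fun e s' =>
    \sum_(o <- ups g' s') K e o)) =
  \sum_(o <- ups g s) cross W120 a o K.

Hypothesis downE : forall a i (K : aux -> label -> label -> R),
  cross W120 a i (fun c i' => \sum_(st <- downs i') K c st.1 st.2) =
  \sum_(st <- downs i) cross W0 a st.1 (fun e s' =>
    cross W60 e st.2 (fun c t' => K c s' t')).

(** Induction along the strip: the line is pulled over the first downward triangle by [downE], then
    over the upward triangle before it by [upE], and then faces the rest of the strip in the same
    position as at the start. *)
Lemma strip_line a g w d (K : aux -> seq label -> R) :
  cross W60 a g (fun b g' => line W120 b w (fun c w' =>
    cross W0 c d (fun e d' => \sum_(x <- stripl g' w' d') K e x))) =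
  \sum_(x <- stripl g w d) line W120 a x K.
Proof.
elim: w a g K => [|i w IHw] a g K.
  rewrite big_stripl_nil.
  transitivity (\sum_(o <- ups g d) cross W120 a o (fun e o => K e [:: o])).
    rewrite -upE; apply: eq_cross => b g'; rewrite line_nil.
    by apply: eq_cross => e d'; rewrite big_stripl_nil.
  apply: eq_bigr => o _; rewrite line_cons; apply: eq_cross => b y.
  by rewrite line_nil.
rewrite big_stripl_cons.
pose rest c t' o := line W120 c w (fun c2 w' => cross W0 c2 d (fun e d' =>
  \sum_(x <- stripl t' w' d') K e (o :: x))).
transitivity (cross W60 a g (fun b g' => cross W120 b i (fun c i' =>
   \sum_(st <- downs i') \sum_(o <- ups g' st.1) rest c st.2 o))).
  apply: eq_cross => b g'; rewrite line_cons; apply: eq_cross => c i'.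
  rewrite /rest.
  under [RHS]eq_bigr do rewrite -line_sum.
  rewrite -line_sum; apply: eq_line => c2 w'.
  under [RHS]eq_bigr do rewrite -cross_sum.
  rewrite -cross_sum; apply: eq_cross => e d'.
  by rewrite big_stripl_cons.
under eq_cross do rewrite (downE _ _ (fun c s t => \sum_(o <- ups _ s) rest c t o)).
rewrite cross_sum; apply: eq_bigr => -[s t] _ /=.
transitivity (cross W60 a g (fun b g' => cross W0 b s (fun e s' =>
   \sum_(o <- ups g' s') cross W60 e t (fun c t' => rest c t' o)))).
  by apply: eq_cross => b g'; apply: eq_cross => e s'; rewrite cross_sum.
rewrite (upE a g s (fun e o => cross W60 e t (fun c t' => rest c t' o))).
apply: eq_bigr => o _.
transitivity (cross W120 a o (fun e o' => \sum_(x <- stripl t w d)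
   line W120 e x (fun f v => K f (o' :: v)))).
  by apply: eq_cross => e o'; rewrite -IHw.
rewrite cross_sum; apply: eq_bigr => x _; by rewrite line_cons.
Qed.

(** One application of [strip_line] per strip, innermost strip first. The line comes down the leg
    [gamma] from its outer end, so the innermost leg edge is the last one crossed before the base;
    hence [rev] and [line_rcons]. *)
Lemma trap_line a w gamma delta (K : aux -> seq label -> R) :
  size gamma = size delta ->
  line W60 a (rev gamma) (fun b gr => line W120 b w (fun c w' =>
    line W0 c delta (fun e delta' =>
      \sum_(x <- trapl w' (rev gr) delta') K e x))) =
  \sum_(x <- trapl w gamma delta) line W120 a x K.
Proof.
elim: gamma delta w a K => [|g gamma IH] [|d delta] w a K //=.
  move=> _; rewrite line_nil big_seq1; apply: eq_line => b v.
  by rewrite line_nil big_seq1.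
case=> sz; rewrite rev_cons line_rcons big_trapl_cons.
transitivity (line W60 a (rev gamma) (fun b v =>
  \sum_(x <- stripl g w d) line W120 b x (fun e x' =>
    line W0 e delta (fun e' delta' =>
      \sum_(y <- trapl x' (rev v) delta') K e' y)))).
  apply: eq_line => b v; rewrite -strip_line; apply: eq_cross => c g'.
  apply: eq_line => e w'; rewrite line_cons; apply: eq_cross => f d'.
  rewrite -line_sum; apply: eq_line => h delta'.
  by rewrite rev_rcons big_trapl_cons.
by rewrite line_sum; apply: eq_bigr => x _; apply: IH.
Qed.

End Lines.

(** * Words and vertical strips *)

Arguments ones s : simpl never.
Arguments zeros s : simpl never.

Fixpoint words (n : nat) : seq (seq bool) :=
  if n is n'.+1 then
    map (cons false) (words n') ++ map (cons true) (words n')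
  else [:: [::]].

Lemma mem_words n w : (w \in words n) = (size w == n).
Proof.
have cons_inj (b : bool) : injective (cons b) by move=> x y [].
have cons_notin (b c : bool) v s : b != c -> (b :: v \in map (cons c) s) = false.
  by move=> bc; apply/mapP => -[x _ [e _]]; rewrite e eqxx in bc.
elim: n w => [|n IHn] [|b w] //=.
  by rewrite mem_cat; apply/norP; split; apply/mapP => -[].
by rewrite eqSS -IHn mem_cat; case: b;
  rewrite ?(mem_map (@cons_inj _)) cons_notin // ?orbF.
Qed.

Lemma uniq_words n : uniq (words n).
Proof.
elim: n => //= n IHn; rewrite cat_uniq !map_inj_uniq ?IHn //=; last 2 first.
- by move=> x y [].
- by move=> x y [].
by rewrite andbT; apply/hasPn => _ /mapP[x _ ->]; apply/mapP => -[].
Qed.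

Lemma big_words0 (M : nmodType) (F : seq bool -> M) :
  \sum_(w <- words 0) F w = F [::].
Proof. exact: big_seq1. Qed.

Lemma big_wordsS (M : nmodType) n (F : seq bool -> M) :
  \sum_(w <- words n.+1) F w =
  \sum_(w <- words n) F (false :: w) + \sum_(w <- words n) F (true :: w).
Proof. by rewrite big_cat !big_map. Qed.

Lemma eq_big_words (M : nmodType) n (F G : seq bool -> M) :
  (forall w, size w = n -> F w = G w) ->
  \sum_(w <- words n) F w = \sum_(w <- words n) G w.
Proof. by move=> FG; apply: eq_big_seq => w; rewrite mem_words => /eqP/FG. Qed.

Lemma big_words_pick (M : nmodType) n (P : pred (seq bool)) (F : seq bool -> M) w0 :
  size w0 = n -> P w0 -> (forall w, size w = n -> P w -> w != w0 -> F w = 0) ->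
  \sum_(w <- words n | P w) F w = F w0.
Proof.
move=> w0n Pw0 F0; rewrite big_mkcond (bigD1_seq w0) ?uniq_words //= ?Pw0; last first.
  by rewrite mem_words w0n.
rewrite big1_seq ?addr0 // => w /andP[ne]; rewrite mem_words => /eqP wn.
by case: ifP => // Pw; apply: F0.
Qed.

(* [hop a x y]: y is obtained from x by moving some of the letters 1 one step to
   the left, where if [a] the leading 1 of x moves out of the word. *)
Fixpoint hop (a : bool) (x y : seq bool) : bool :=
  match x, y with
  | [::], [::] => ~~ a
  | b :: x', c :: y' =>
      if b then (if a then hop c x' y' else c && hop false x' y')
      else ~~ a && hop c x' y'
  | _, _ => false
  end.

(** The number of pairs of a 1 and a later 0, which is the size of the partition of the word. *)
Fixpoint deg (w : seq bool) : nat :=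
  if w is b :: w' then (b * zeros w' + deg w')%N else 0%N.

Lemma zeros_cons b w : zeros (b :: w) = (~~ b + zeros w)%N.
Proof. by case: b. Qed.
Lemma ones_cons b w : ones (b :: w) = (b + ones w)%N.
Proof. by case: b. Qed.
Lemma zerosDones w : (zeros w + ones w)%N = size w.
Proof. by rewrite addnC -(count_predC (pred1 true)); congr addn; apply: eq_count; case. Qed.

Lemma hop_size a x y : hop a x y -> size x = size y.
Proof.
elim: x a y => [|b x IH] a [|c y] //=; case: b; case: a => //=.
- by move=> /IH ->.
- by case/andP=> _ /IH ->.
- by move=> /IH ->.
Qed.

Lemma hop_ones a x y : hop a x y -> ones x = (a + ones y)%N.
Proof.
elim: x a y => [|b x IH] a [|c y] //=; first by case: a.
case: b; case: a => //=; rewrite !ones_cons.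
- by move=> /IH ->.
- by case: c => //= /IH ->.
- by move=> /IH ->; case: c.
Qed.

Lemma hop_zeros a x y : hop a x y -> (a + zeros x)%N = zeros y.
Proof.
move=> h; have := hop_size h; have := hop_ones h.
rewrite -(zerosDones x) -(zerosDones y); lia.
Qed.

Section HopWeight.
Variables (R : comNzRingType) (t : R).

Fixpoint hopw (a : bool) (x y : seq bool) : R :=
  match x, y with
  | [::], [::] => (~~ a)%:R
  | b :: x', c :: y' =>
      if b then (if a then t ^+ c * hopw c x' y' else c%:R * hopw false x' y')
      else (~~ a)%:R * (t ^+ c * hopw c x' y')
  | _, _ => 0
  end.

(** For [a] true, [hop true x y] is the tail of [hop false (false :: x) (true :: y)]. The exponent
    is the degree difference of these longer words minus 1, the factor already paid at the first
    letter. *)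
Lemma hopw_deg a x y : hop a x y -> (deg x + a <= deg y + a * zeros y)%N /\
  hopw a x y = t ^+ (deg y + a * zeros y - (deg x + a)).
Proof.
elim: x a y => [|b x IH] a [|c y] //=; first by case: a; rewrite ?expr0.
case: b; case: a => //=; rewrite ?mul1r ?mul0r ?zeros_cons.
- move=> h; have := hop_zeros h; have [le ->] := IH _ _ h.
  rewrite -exprD => z; split; first by case: c le z {h} => /=; lia.
  by congr (_ ^+ _); case: c le z {h} => /=; lia.
- case: c => //= h; have := hop_zeros h; have [le ->] := IH _ _ h.
  by rewrite !mul1r => z; split; [lia | congr (_ ^+ _); lia].
- move=> h; have := hop_zeros h; have [le ->] := IH _ _ h.
  rewrite -exprD => z; split; first by case: c le z {h} => /=; lia.
  by congr (_ ^+ _); case: c le z {h} => /=; lia.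
Qed.

Lemma hopw_eq0 a x y : ~~ hop a x y -> hopw a x y = 0.
Proof.
elim: x a y => [|b x IH] a [|c y] //=; first by case: a.
case: b; case: a => //=; rewrite ?mul0r //.
- by move/IH ->; rewrite mulr0.
- by case: c => //= [/IH->|]; rewrite (mul0r, mulr0).
- by move/IH ->; rewrite !mulr0.
Qed.

Lemma hopwE x y :
  hopw false x y = (hop false x y)%:R * t ^+ (deg y - deg x).
Proof.
case: (boolP (hop _ _ _)) => [h|/hopw_eq0 -> //]; last by rewrite mul0r.
by have [_ ->] := hopw_deg h; rewrite !mul0n !addn0 mul1r.
Qed.

End HopWeight.

Lemma hop_deg x y : hop false x y -> (deg x <= deg y)%N.
Proof. by case/(hopw_deg (1 : int)); rewrite !addn0. Qed.

(** * The Yang-Baxter equation for puzzles *)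

Definition emb (w : seq bool) : seq label := [seq label_of_bool b | b <- w].

Lemma emb_inj : injective emb.
Proof. by apply: inj_map; case; case. Qed.

(** [auxB] is the idle state, in which the line enters and must leave. A letter 1 in transit is
    [auxA] along a word ([W120]) and [auxC] along the NW side ([W60]). *)
Variant aux := auxA | auxB | auxC.

Section Weights.
Variables (R : comNzRingType) (t : R).
Local Notation cr := (crossing R aux).

(* A line in state [a] crosses an edge labeled [l]: the list of the possible
   (weight, (new state, new label)). *)
Definition W60 : cr := fun a l =>
  match a, l with
  | auxA, L0 => [:: (t, (auxB, L10))]
  | auxA, L1 => [:: (1, (auxA, L1)); (t, (auxC, L10))]
  | auxA, L10 => [:: (t, (auxA, L10))]
  | auxB, L0 => [:: (1, (auxB, L0))]
  | auxB, L1 => [:: (1, (auxB, L1)); (1, (auxC, L0))]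
  | auxB, L10 => [:: (1, (auxB, L10)); (1, (auxA, L0))]
  | auxC, L0 => [:: (t, (auxB, L1))]
  | auxC, L1 => [:: (t, (auxC, L1))]
  | auxC, L10 => [:: (t, (auxA, L1))]
  end.

Definition W120 : cr := fun a l =>
  match a, l with
  | auxA, L0 => [:: (t * t, (auxB, L1))]
  | auxA, L1 => [:: (t * t, (auxA, L1))]
  | auxA, L10 => [::]
  | auxB, L0 => [:: (t, (auxB, L0))]
  | auxB, L1 => [:: (t, (auxB, L1)); (t, (auxA, L0)); (t, (auxC, L10))]
  | auxB, L10 => [:: (t, (auxB, L10))]
  | auxC, L0 => [:: (t, (auxC, L0))]
  | auxC, L1 => [:: (t * t, (auxC, L1))]
  | auxC, L10 => [:: (t * t, (auxB, L1))]
  end.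

Definition W0 : cr := fun a l =>
  match a, l with
  | auxA, L0 => [:: (t, (auxA, L0)); (t, (auxC, L1))]
  | auxA, L1 => [::]
  | auxA, L10 => [::]
  | auxB, L0 => [:: (t, (auxB, L0)); (1, (auxC, L10))]
  | auxB, L1 => [:: (t, (auxB, L1))]
  | auxB, L10 => [::]
  | auxC, L0 => [:: (-1, (auxC, L0))]
  | auxC, L1 => [:: (t, (auxC, L1)); (t, (auxA, L0))]
  | auxC, L10 => [:: (1, (auxC, L10)); (t, (auxB, L0))]
  end.

Lemma W_up a g s (K : aux -> label -> R) :
  cross W60 a g (fun b g' => cross W0 b s (fun e s' =>
    \sum_(o <- ups g' s') K e o)) =
  \sum_(o <- ups g s) cross W120 a o K.
Proof.
by rewrite /cross; case: a g s => [] [] [];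
   rewrite /= !(big_cons, big_nil) /= ?(big_cons, big_nil) /=; ring.
Qed.

Lemma W_down a i (K : aux -> label -> label -> R) :
  cross W120 a i (fun c i' => \sum_(st <- downs i') K c st.1 st.2) =
  \sum_(st <- downs i) cross W0 a st.1 (fun e s' =>
    cross W60 e st.2 (fun c t' => K c s' t')).
Proof.
by rewrite /cross; case: a i => [] [];
   rewrite /= !(big_cons, big_nil) /= ?(big_cons, big_nil) /=; ring.
Qed.

End Weights.

(** * The relation between [Tr] and vertical strips *)

Definition isB (a : aux) : bool := if a is auxB then true else false.

(** All words follow the strips: [beta] and [nu] run from the NW side to the South side, the legs
    [gamma] and [delta] from the base outwards. So [beta] and [delta] are the reversals of the
    clockwise labels. *)
Definition Tr (beta gamma nu delta : seq bool) : nat :=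
  count_mem (emb nu) (trapl (emb beta) (emb gamma) (emb delta)).

Lemma size_emb w : size (emb w) = size w. Proof. exact: size_map. Qed.

Lemma size_stripl g w d x : x \in stripl g w d -> size x = (size w).+1.
Proof.
elim: w g x => [|i w IH] g x /=; first by case/mapP => o _ ->.
case/allpairsPdep=> -[s t] [r [_ +]]; case: r => o y /= + ->.
by case/allpairsPdep => o' [y' [_ /IH <- [_ ->]]].
Qed.

Lemma size_trapl w gamma delta x : size gamma = size delta ->
  x \in trapl w gamma delta -> size x = (size w + size gamma)%N.
Proof.
elim: gamma delta w => [|g gamma IH] [|d delta] w //=.
  by rewrite inE addn0 => _ /eqP ->.
by case=> sz /flattenP[_ /mapP[w' /size_stripl w's ->]] /IH -> //; rewrite w's addSnnS.
Qed.

Section Relation.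
Variables (R : comNzRingType) (t : R).

(* [rev]: the line crosses the legs of the NW side from top to bottom. *)
Lemma line60 gamma (F : aux -> seq label -> R) :
  line (W60 t) auxB (rev (emb gamma)) F =
  \sum_(y <- words (size gamma)) hopw t false gamma y * F auxB (rev (emb y)) +
  \sum_(y <- words (size gamma)) hopw t true gamma y * F auxC (rev (emb y)).
Proof.
elim: gamma F => [|g x IH] F.
  by rewrite line_nil !big_words0 /= mul1r mul0r addr0.
rewrite [emb _]/= rev_cons line_rcons IH /cross !big_wordsS /=.
case: g; rewrite /= ?big_cons ?big_nil /= ?addr0 ?mul1r.
- under eq_bigr do rewrite big_cons big_seq1 /= !mul1r mulrDr -!rev_cons.
  rewrite big_split /=.
  rewrite [X in _ = X + _ + _]big1 ?add0r; last by move=> y _; rewrite !mul0r.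
  under [X in _ + X]eq_bigr do rewrite big_seq1 /= -rev_cons mulrA.
  rewrite -!addrA; congr (_ + _).
    by apply: eq_bigr => y _; rewrite mul1r.
  congr (_ + _); apply: eq_bigr => y _; first by rewrite expr0 mul1r.
  by rewrite expr1 (mulrC t).
- under eq_bigr do rewrite big_seq1 /= !mul1r -!rev_cons.
  under [X in _ + X]eq_bigr do rewrite big_seq1 /= -rev_cons mulrA.
  rewrite [X in _ = _ + (X + _)]big1 ?add0r; last by move=> y _; rewrite !mul0r.
  rewrite [X in _ = _ + X]big1 ?addr0; last by move=> y _; rewrite !mul0r.
  by congr (_ + _); apply: eq_bigr => y _; rewrite ?expr0 !mul1r // expr1 (mulrC t).
Qed.

(** Under [W120] only the label [L10] leads out of [auxC], and a binary word has none. So a letter 1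
    carried down the NW side cannot be passed on to the base. *)
Lemma line120_C y F : (forall a v, ~~ isB a -> F a v = 0) ->
  line (W120 t) auxC (emb y) F = 0.
Proof.
elim: y F => [|b y IH] F F0; first by rewrite line_nil F0.
rewrite /= line_cons /cross; case: b => /=;
  by rewrite big_seq1 /= IH ?mulr0 // => a v /F0.
Qed.

(** The line reads the larger word [y] and leaves the smaller word [x], so along the base it removes
    a vertical strip. The power of t in front is the common normalization of the weights of
    [W120]. *)
Lemma line120 (a : bool) y (F : aux -> seq label -> R) :
  (forall b v, ~~ isB b -> F b v = 0) ->
  line (W120 t) (if a then auxA else auxB) (emb y) F =
  t ^+ (size y + a) *
    \sum_(x <- words (size y)) hopw t a x y * F auxB (emb x).
Proof.
elim: y a F => [|b y IH] a F F0.
  rewrite line_nil big_words0 /=; case: a => /=; last by rewrite expr0 !mul1r.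
  by rewrite F0 // mul0r mulr0.
have F0' l c v : ~~ isB c -> F c (l :: v) = 0 by move/F0.
rewrite [emb _]/= line_cons /cross big_wordsS /=.
case: a; case: b => /=; rewrite ?big_cons ?big_nil /= ?addr0.
- rewrite (IH true _ (F0' L1)) [X in _ = _ * (X + _)]big1 ?add0r; last first.
    by move=> x _; rewrite !mul0r.
  under [X in _ = _ * X]eq_bigr do rewrite -mulrA.
  rewrite -big_distrr /= !addn1 expr1 !exprS; ring.
- rewrite (IH false _ (F0' L1)) [X in _ = _ * (X + _)]big1 ?add0r; last first.
    by move=> x _; rewrite !mul0r.
  under [X in _ = _ * X]eq_bigr do rewrite -mulrA.
  rewrite -big_distrr /= addn1 addn0 expr0 !exprS; ring.
- rewrite (IH false _ (F0' L1)) (IH true _ (F0' L0)) (line120_C _ (F0' L10)) mulr0 addr0.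
  under [X in _ = _ * (X + _)]eq_bigr do rewrite mul1r -mulrA.
  under [X in _ = _ * (_ + X)]eq_bigr do rewrite mul1r.
  rewrite -big_distrr /= addn1 !addn0 expr1 !exprS; ring.
- rewrite (IH false _ (F0' L0)) [X in _ = _ * (_ + X)]big1 ?addr0; last first.
    by move=> x _; rewrite !mul0r.
  under [X in _ = _ * X]eq_bigr do rewrite !mul1r.
  rewrite !addn0 exprS; ring.
Qed.

(** Under [W0] the state [auxB] is entered from another state only at a label [L10]. On a binary
    word a line that ends idle was therefore idle throughout, and this is why [delta] stays fixed in
    the relation. *)
Lemma line0 a d (F : aux -> seq label -> R) :
  (forall b v, ~~ isB b -> F b v = 0) ->
  line (W0 t) a (emb d) F = if isB a then t ^+ size d * F auxB (emb d) else 0.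
Proof.
elim: d a F => [|b d IH] a F F0.
  by rewrite line_nil mul1r; case: a => //=; rewrite F0.
have F0' l c v : ~~ isB c -> F c (l :: v) = 0 by move/F0.
rewrite [emb _]/= line_cons /cross.
case: a; case: b => /=; rewrite ?big_cons ?big_nil /= ?(IH _ _ (F0' _)) /= ?mulr0 ?addr0 //.
all: by rewrite exprS mulrA.
Qed.

(** Now the output is prescribed and the input [o] may contain [L10]. Such a label stops the line,
    reappears in the output, or is read in [auxC], a state entered only by writing [L10]; a binary
    output excludes all three. *)
Lemma line120_out (a : bool) x (o : seq label) : size o = size x ->
  line (W120 t) (if a then auxA else auxB) o
    (fun b v => (isB b && (v == emb x))%:R) =
  t ^+ (size x + a) *
    \sum_(y <- words (size x)) hopw t a x y * (o == emb y)%:R.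
Proof.
have C0 o' b x' : line (W120 t) auxC o' (fun c v => (isB c && (L10 :: v == emb (b :: x')))%:R) = 0.
  rewrite /line big1 // => -[w [c v]] _ /=.
  by rewrite eqseq_cons; case: b; rewrite andbF mulr0.
elim: x a o => [|b x IH] a [|l o] // so.
  rewrite line_nil big_words0; case: a => /=; first by rewrite mul0r mulr0.
  by rewrite expr0 !mul1r.
case: so => so; rewrite line_cons /cross big_wordsS /=.
have eqc c d v w : (label_of_bool c :: v == label_of_bool d :: w) = (c == d) && (v == w).
  by rewrite eqseq_cons; case: c; case: d.
have eqX d v w : (L10 :: v == label_of_bool d :: w) = false.
  by rewrite eqseq_cons; case: d.
have eq0X d v w : (label_of_bool d == L10) = false by case: d.
have st c v e : (isB c && (label_of_bool e :: v == emb (b :: x))) = (e == b) && (isB c && (v == emb x)).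
  by rewrite /= eqc andbCA.
have lst a' e : line (W120 t) a' o (fun c v => (isB c && (label_of_bool e :: v == emb (b :: x)))%:R) =
   (e == b)%:R * line (W120 t) a' o (fun c v => (isB c && (v == emb x))%:R).
  rewrite /line big_distrr; apply: eq_bigr => q _ /=.
  by rewrite st; case: (e == b); rewrite ?mul1r ?mul0r ?mulr0.
have lst0 a' := lst a' false; have lst1 a' := lst a' true.
rewrite /= in lst0 lst1.
have IHA := IH true o so; have IHB := IH false o so; rewrite /= in IHA IHB.
have sumX c (r : seq (seq bool)) (G : seq bool -> R) :
    \sum_(y <- r) G y * (L10 :: o == label_of_bool c :: emb y)%:R = 0.
  by rewrite big1 // => y _; rewrite eqX mulr0.
have sumE c d (r : seq (seq bool)) (G : seq bool -> R) :
    \sum_(y <- r) G y * (label_of_bool c :: o == label_of_bool d :: emb y)%:R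
   = (c == d)%:R * \sum_(y <- r) G y * (o == emb y)%:R.
  rewrite big_distrr; apply: eq_bigr => y _ /=.
  by rewrite eqc; case: (c == d); rewrite ?mul1r ?mul0r ?mulr0.
have [sX0 sX1] := (sumX false, sumX true).
have [s00 s01] := (sumE false false, sumE false true).
have [s10 s11] := (sumE true false, sumE true true).
rewrite /= in sX0 sX1 s00 s01 s10 s11.
have dist (r : seq (seq bool)) (G H : seq bool -> R) k : (forall y, G y = k * H y) ->
  \sum_(y <- r) G y * (o == emb y)%:R = k * \sum_(y <- r) H y * (o == emb y)%:R.
  by move=> e; rewrite big_distrr; apply: eq_bigr => y _ /=; rewrite e mulrA.
case: l => /=; last 1 first.
- case: a; rewrite /= ?big_nil ?big_seq1 /= !(sX0, sX1) ?addr0 ?mulr0 //.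
  by rewrite /line big1 ?mulr0 // => q _; rewrite eqX andbF mulr0.
- rewrite s00 s01 mul0r addr0 mul1r.
  case: a; rewrite ?big_seq1 /= ?lst0 ?lst1 ?IHA ?IHB.
    case: b {lst st lst0 lst1 IHA C0} => /=.
      rewrite [in RHS](dist _ _ (hopw t false x) 1); last by move=> y; rewrite expr0.
      rewrite !addn1 !addn0 !exprS; ring.
    rewrite [in RHS](dist _ _ (hopw t false x) 0); last by move=> y; rewrite !mul0r.
    ring.
  case: b {lst st lst0 lst1 IHA C0} => /=.
    rewrite [in RHS](dist _ _ (hopw t false x) 0); last by move=> y; rewrite !mul0r.
    ring.
  rewrite [in RHS](dist _ _ (hopw t false x) 1); last by move=> y; rewrite expr0 !mul1r.
  rewrite !addn0 !exprS; ring.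
- rewrite s10 mul0r add0r s11 mul1r.
  case: a; rewrite ?big_cons ?big_nil /= ?lst0 ?lst1 ?IHA ?IHB ?C0 ?mulr0 ?addr0.
    case: b {lst st lst0 lst1 IHB C0} => /=.
      rewrite [in RHS](dist _ _ (hopw t true x) t) // !addn1 !exprS; ring.
    rewrite [in RHS](dist _ _ (hopw t true x) 0); last by move=> y; rewrite !mul0r.
    ring.
  case: b {lst st lst0 lst1 C0} => /=.
    rewrite [in RHS](dist _ _ (hopw t false x) 1); last by move=> y.
    rewrite !addn0 !exprS; ring.
  rewrite [in RHS](dist _ _ (hopw t true x) t); last by move=> y; rewrite expr1 mul1r.
  rewrite !addn1 !addn0 !exprS; ring.
Qed.

End Relation.

Lemma sum_eq_count (T : eqType) (R : pzSemiRingType) (s : seq T) (c : T) :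
  \sum_(x <- s) (x == c)%:R = (count_mem c s)%:R :> R.
Proof.
rewrite -sum1_count natr_sum [RHS]big_mkcond /=.
by apply: eq_bigr => x _; case: eqP.
Qed.

Lemma Tr_hopw (beta gamma nu delta : seq bool) :
  size gamma = size delta -> size nu = (size beta + size gamma)%N ->
  \sum_(y <- words (size nu)) hopw 'X false nu y * (Tr beta gamma y delta)%:R =
  \sum_(b <- words (size beta)) \sum_(g <- words (size gamma))
    hopw 'X false b beta * hopw 'X false gamma g * (Tr b g nu delta)%:R
  :> {poly int}.
Proof.
move=> sgd snu; set t := 'X : {poly int}.
(* Both sides carry the factor t ^ size nu: from the NE side on one hand, from the base and the
   South side together on the other. It can be cancelled because t is an indeterminate. *)
have reg n (P Q : {poly int}) : t ^+ n * P = t ^+ n * Q -> P = Q.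
  by apply: mulfI; rewrite expf_neq0 // polyX_eq0.
apply: (reg (size nu)).
have := @trap_line _ _ (W60 t) (W120 t) (W0 t) (W_up t) (W_down t) auxB
  (emb beta) (emb gamma) (emb delta) (fun e x => (isB e && (x == emb nu))%:R).
rewrite !size_emb => /(_ sgd).
have K0 c (s : seq (seq label)) : ~~ isB c ->
  \sum_(x <- s) (isB c && (x == emb nu))%:R = 0 :> {poly int}.
  by case: c => //= _; rewrite big1.
have inner c w' gr : line (W0 t) c (emb delta) (fun e delta' =>
    \sum_(x <- trapl w' (rev gr) delta') (isB e && (x == emb nu))%:R) =
  if isB c then t ^+ size delta *
    (count_mem (emb nu) (trapl w' (rev gr) (emb delta)))%:R else 0.
  rewrite line0 => [|b v /K0 -> //]; case: ifP => // _.
  by rewrite -sum_eq_count.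
rewrite line60 [X in _ + X]big1 ?addr0 => [|y _]; last first.
  by rewrite line120_C ?mulr0 // => a v aB; rewrite inner (negPf aB).
move=> E.
transitivity (\sum_(x <- trapl (emb beta) (emb gamma) (emb delta))
   line (W120 t) auxB x (fun b v => (isB b && (v == emb nu))%:R)).
  rewrite [RHS](eq_big_seq (fun x => t ^+ size nu * \sum_(y <- words (size nu))
    hopw t false nu y * (x == emb y)%:R)) => [|x].
    rewrite -big_distrr exchange_big /=; congr (_ * _).
    by apply: eq_bigr => y _; rewrite -big_distrr /= sum_eq_count.
  move=> /size_trapl; rewrite !size_emb => /(_ sgd) sx.
  by rewrite (line120_out t false) ?addn0 // sx snu.
rewrite -E exchange_big big_distrr /=; apply: eq_bigr => g _.
rewrite (line120 t false) => [|b v bB]; last by rewrite inner (negPf bB).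
rewrite addn0 snu exprD !big_distrr /=; apply: eq_bigr => b _.
rewrite inner /= revK -/(Tr _ _ _ _). rewrite -sgd; ring.
Qed.

Lemma Tr_hop_r (r : nat) (beta gamma nu delta : seq bool) :
  size gamma = size delta -> size nu = (size beta + size gamma)%N ->
  \sum_(y <- words (size nu) | hop false nu y && (deg y - deg nu == r)%N)
    Tr beta gamma y delta =
  \sum_(b <- words (size beta)) \sum_(g <- words (size gamma) |
    [&& hop false b beta, hop false gamma g &
        (deg beta - deg b + (deg g - deg gamma) == r)%N])
    Tr b g nu delta.
Proof.
move=> sgd snu; have := congr1 (fun p : {poly int} => p`_r) (Tr_hopw sgd snu).
have cf (c : bool) k m : ((c%:R * 'X^k * m%:R : {poly int})`_r) =
    (if c && (k == r) then m else 0%N)%:R.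
  rewrite -!polyC_natr mulrAC -polyCM coefCM coefXn eq_sym.
  by case: c; case: (k == r); rewrite /= ?mul1r ?mul0r ?mulr1 ?mulr0.
rewrite !coef_sum.
under eq_bigr do rewrite hopwE cf.
under [X in _ = X -> _]eq_bigr => b _.
  rewrite coef_sum; under eq_bigr do rewrite !hopwE mulrACA -natrM mulnb -exprD cf -andbA.
  over.
move=> E; apply/eqP; rewrite -(Num.Theory.eqr_nat int); apply/eqP.
rewrite big_mkcond !natr_sum /= E; apply: eq_bigr => b _.
by rewrite [in RHS]big_mkcond natr_sum.
Qed.

(** * Boundary strips *)

(** A leading 0 of the inner word forces the first two triangles: 0 is copied to the outer word and
    the label [g] is handed on unchanged, so the rest of the strip is that of [w]. *)
Lemma stripl_cons0 (g : bool) w d :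
  stripl (label_of_bool g) (L0 :: w) d =
  map (cons L0) (stripl (label_of_bool g) w d).
Proof. by case: g; rewrite /= ?cats0 -map_comp. Qed.

Lemma trapl_cons0 w gamma delta :
  trapl (L0 :: w) (emb gamma) delta = map (cons L0) (trapl w (emb gamma) delta).
Proof.
elim: gamma delta w => [|g gamma IH] [|d delta] w //.
have trE v : trapl v (emb (g :: gamma)) (d :: delta) =
  flatten [seq trapl v' (emb gamma) delta | v' <- stripl (label_of_bool g) v d].
  by [].
rewrite !trE stripl_cons0 map_flatten -!map_comp.
by congr flatten; apply: eq_map => x /=; rewrite IH.
Qed.

Lemma Tr_cons0 beta gamma nu delta :
  Tr (false :: beta) gamma nu delta =
  if nu is false :: nu' then Tr beta gamma nu' delta else 0%N.
Proof.
rewrite /Tr [emb (false :: _)]/= trapl_cons0 count_map.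
case: nu => [|[] nu].
- by rewrite (@eq_count _ _ pred0) ?count_pred0.
- by rewrite (@eq_count _ _ pred0) ?count_pred0.
- by apply: eq_count => x /=; rewrite eqseq_cons eqxx.
Qed.

Lemma stripl_rcons1 g w (d : bool) :
  stripl g (rcons w L1) (label_of_bool d) =
  map (rcons^~ L1) (stripl g w (label_of_bool d)).
Proof.
elim: w g => [|i w IH] g; first by case: d; case: g.
rewrite /= map_flatten -map_comp; congr flatten; apply: eq_map => -[s t] /=.
rewrite -map_comp IH /= map_allpairs /allpairs_dep !map_flatten -!map_comp.
by congr flatten; apply: eq_map => o /=; rewrite -!map_comp; apply: eq_map.
Qed.

Lemma trapl_rcons1 w gamma delta :
  trapl (rcons w L1) gamma (emb delta) =
  map (rcons^~ L1) (trapl w gamma (emb delta)).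
Proof.
elim: gamma delta w => [|g gamma IH] [|d delta] w //.
have trE v : trapl v (g :: gamma) (emb (d :: delta)) =
  flatten [seq trapl v' gamma (emb delta) | v' <- stripl g v (label_of_bool d)].
  by [].
rewrite !trE stripl_rcons1 map_flatten -!map_comp.
by congr flatten; apply: eq_map => x /=; rewrite IH.
Qed.

Lemma Tr_rcons1 beta gamma nu delta :
  Tr (rcons beta true) gamma (rcons nu true) delta = Tr beta gamma nu delta.
Proof.
rewrite /Tr /emb !map_rcons trapl_rcons1 count_map.
by apply: eq_count => x /=; rewrite eqseq_rcons eqxx andbT.
Qed.

(** The sorted word, whose partition is empty. *)
Definition vac p q : seq bool := nseq p false ++ nseq q true.

Definition cst g w d (o : seq label) : nat := count_mem o (stripl g w d).

Lemma cst_nil g d o : cst g [::] d o = count (fun l => [:: l] == o) (ups g d).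
Proof. by rewrite /cst /= count_map. Qed.

Lemma cst_cons g i w d l o :
  cst g (i :: w) d (l :: o) =
  (\sum_(st <- downs i | l \in ups g st.1) cst st.2 w d o)%N.
Proof.
have cstE h v e c : cst h v e c = (\sum_(x <- stripl h v e) (x == c : nat))%N.
  by rewrite /cst -sum1_count big_mkcond; apply: eq_bigr => x _ /=; case: eqP.
rewrite cstE.
have -> : forall K, (\sum_(x <- stripl g (i :: w) d) K x =
  \sum_(st <- downs i) \sum_(o <- ups g st.1)
    \sum_(x <- stripl st.2 w d) K (o :: x))%N by exact: (@big_stripl_cons nat).
rewrite [RHS]big_mkcond; apply: eq_bigr => -[s t] _ /=.
rewrite cstE; case: ifP => lin.
  rewrite (bigD1_seq l) ?filter_uniq //= [X in (_ + X)%N]big1 ?addn0 => [|o' /negPf ne].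
    by apply: eq_bigr => x _; rewrite eqseq_cons eqxx.
  by rewrite big1 // => x _; rewrite eqseq_cons ne.
rewrite big1_seq // => o' /= o'in; rewrite big1 // => x _.
by rewrite eqseq_cons; case: eqP => // e; rewrite -e o'in in lin.
Qed.

Lemma cst_size g w d o : size o != (size w).+1 -> cst g w d o = 0%N.
Proof.
move=> so; apply/count_memPn; apply/negP => /size_stripl e.
by rewrite e eqxx in so.
Qed.

Definition nexts (g i l : label) : seq label :=
  [seq st.2 | st <- downs i & l \in ups g st.1].

Lemma cst_next g i w d l o :
  cst g (i :: w) d (l :: o) = (\sum_(t <- nexts g i l) cst t w d o)%N.
Proof. by rewrite cst_cons /nexts big_map big_filter. Qed.

Lemma nexts_emb g i (l : bool) : nexts g i (label_of_bool l) =
  match g, i, l with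
  | L0, L0, false => [:: L0]
  | L0, L1, false => [:: L10]
  | L1, L0, false => [:: L1]
  | L1, L1, true => [:: L1]
  | L1, L10, true => [:: L0]
  | L10, L0, true => [:: L0]
  | L10, L1, true => [:: L10]
  | _, _, _ => [::]
  end.
Proof. by case: g; case: i; case: l. Qed.

Lemma cst_emb g i w d (l : bool) o :
  cst g (i :: w) d (emb (l :: o)) =
  match g, i, l with
  | L0, L0, false => cst L0 w d (emb o)
  | L0, L1, false => cst L10 w d (emb o)
  | L1, L0, false => cst L1 w d (emb o)
  | L1, L1, true => cst L1 w d (emb o)
  | L1, L10, true => cst L0 w d (emb o)
  | L10, L0, true => cst L0 w d (emb o)
  | L10, L1, true => cst L10 w d (emb o)
  | _, _, _ => 0%N
  end.
Proof.
by rewrite cst_next nexts_emb; case: g; case: i; case: l;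
  rewrite ?big_seq1 ?big_nil.
Qed.

Lemma cst_emb_nil g (d : bool) (o : seq bool) :
  cst g [::] (label_of_bool d) (emb o) =
  match g, o with
  | L0, [:: false] => ~~ d
  | L1, [:: true] => d
  | L10, [:: true] => ~~ d
  | _, _ => false
  end.
Proof. by rewrite cst_nil; case: g; case: d; case: o => [|[] []]. Qed.

(* Outer words with a letter 10 are excluded here since o ranges over emb. *)
Lemma cst_11 (w : seq label) (o : seq bool) :
  cst L1 w L1 (emb o) = (emb o == rcons w L1).
Proof.
suff: [/\ cst L0 w L1 (emb o) = 0%N, cst L10 w L1 (emb o) = 0%N &
  cst L1 w L1 (emb o) = (emb o == rcons w L1)] by case.
elim: w o => [|i w IH] o.
  by rewrite !(cst_emb_nil _ true); case: o => [|[] []].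
case: o => [|l o]; first by rewrite !cst_size.
have [IH0 IHX IH1] := IH o.
by rewrite !cst_emb; case: i; case: l; rewrite /= ?IH0 ?IHX ?IH1 ?eqseq_cons.
Qed.

Lemma vacS p q : vac p.+1 q = false :: vac p q. Proof. by []. Qed.
Lemma vac0S q : vac 0 q.+1 = true :: vac 0 q. Proof. by []. Qed.
Lemma size_vac p q : size (vac p q) = (p + q)%N.
Proof. by rewrite size_cat !size_nseq. Qed.

Lemma cst0_ones w (d : bool) q : cst L0 w (label_of_bool d) (emb (vac 0 q)) = 0%N.
Proof.
case: q => [|q]; first by rewrite cst_size.
rewrite vac0S; case: w => [|i w]; first by rewrite cst_emb_nil.
by rewrite cst_emb; case: i.
Qed.

Lemma cst10_zeros w (d : bool) p q :
  cst L10 w (label_of_bool d) (emb (vac p.+1 q)) = 0%N.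
Proof.
rewrite vacS; case: w => [|i w]; first by rewrite cst_emb_nil.
by rewrite cst_emb; case: i.
Qed.

Lemma cst10_ones w (d : bool) q :
  cst L10 w (label_of_bool d) (emb (vac 0 q.+1)) =
  (~~ d && (w == emb (vac 0 q))).
Proof.
elim: w q => [|i w IH] q.
  by rewrite vac0S cst_emb_nil; case: q; case: d.
rewrite vac0S cst_emb.
case: q => [|q]; first by case: i; rewrite ?cst_size ?andbF.
rewrite cst0_ones IH [in RHS]vac0S eqseq_cons.
by case: i; rewrite ?andbF.
Qed.

(** The labels inside the strip are forced. They stay [L0] along the 0s and turn into [L10] where
    the last 0 of the outer word meets the first 1 of the inner word; [L10] then persists to the
    end, where either label requires [d] to be 0. *)
Lemma cst0_vac w (d : bool) p q :
  cst L0 w (label_of_bool d) (emb (vac p.+1 q)) = (~~ d && (w == emb (vac p q))).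
Proof.
elim: w p q => [|i w IH] p q.
  by rewrite vacS cst_emb_nil; case: p q => [|p] [|q]; case: d.
rewrite vacS cst_emb.
case: p => [|p].
  rewrite cst0_ones; case: q => [|q].
    by case: i; rewrite ?cst_size ?andbF.
  by rewrite cst10_ones [in RHS]vac0S eqseq_cons; case: i; rewrite ?andbF.
by rewrite IH cst10_zeros [in RHS]vacS eqseq_cons; case: i; rewrite ?andbF.
Qed.

Lemma cst1_vac w (d : bool) p q :
  cst L1 w (label_of_bool d) (emb (vac p q.+1)) = (d && (w == emb (vac p q))).
Proof.
elim: w p q => [|i w IH] [|p] q.
- by rewrite vac0S cst_emb_nil; case: q => [|q]; case: d.
- by rewrite vacS cst_emb_nil andbF.
- rewrite vac0S cst_emb.
  rewrite cst0_ones; case: q => [|q]; first by case: i; rewrite ?cst_size ?andbF.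
  by rewrite IH [in RHS]vac0S eqseq_cons; case: i; rewrite ?andbF.
- rewrite vacS cst_emb IH [in RHS]vacS eqseq_cons.
  by case: i; rewrite ?andbF.
Qed.

Lemma cst_vac (g d : bool) w p q :
  cst (label_of_bool g) w (label_of_bool d) (emb (vac (~~ g + p) (g + q))) =
  ((g == d) && (w == emb (vac p q))).
Proof.
case: g; last by rewrite cst0_vac; case: d.
by rewrite cst1_vac; case: d.
Qed.

Lemma count_trapl_cons w g gamma d delta o :
  count_mem o (trapl w (g :: gamma) (d :: delta)) =
  (\sum_(w' <- stripl g w d) count_mem o (trapl w' gamma delta))%N.
Proof. by rewrite /= count_flatten -map_comp sumnE big_map. Qed.

Lemma sum_eq_countN (T : eqType) (s : seq T) (c : T) (b : bool) :
  (\sum_(x <- s) (b && (x == c) : nat))%N = (b * count_mem c s)%N.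
Proof.
rewrite -sum1_count big_distrr [RHS]big_mkcond /=.
by apply: eq_bigr => x _; case: eqP; case: b.
Qed.

(** A sorted outermost word forces sorted words on all lines inside: going inwards, each strip takes
    away one letter, equal to both of its end labels ([cst_vac]). *)
Lemma count_trapl_vac w gamma delta p q : size gamma = size delta ->
  count_mem (emb (vac (zeros gamma + p) (ones gamma + q)))
    (trapl w (emb gamma) (emb delta)) =
  ((gamma == delta) && (w == emb (vac p q))).
Proof.
elim: gamma delta w p q => [|g gamma IH] [|d delta] w p q //.
  by move=> _; rewrite /= addn0.
case=> sz; rewrite (count_trapl_cons _ _ (emb gamma) _ (emb delta)).
have -> : (zeros (g :: gamma) + p = zeros gamma + (~~ g + p))%N.
  by rewrite zeros_cons; lia.
have -> : (ones (g :: gamma) + q = ones gamma + (g + q))%N.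
  by rewrite ones_cons; lia.
under eq_bigr do rewrite IH //.
rewrite sum_eq_countN -/(cst _ _ _ _) cst_vac eqseq_cons mulnb.
by rewrite andbA (andbC (gamma == _)).
Qed.

Lemma Tr_vac beta gamma delta p q : size gamma = size delta ->
  Tr beta gamma (vac (zeros gamma + p) (ones gamma + q)) delta =
  ((gamma == delta) && (beta == vac p q)).
Proof. by move=> /count_trapl_vac; rewrite /Tr => ->; rewrite (inj_eq emb_inj). Qed.

Lemma stripl_00 w : stripl L0 (emb w) L0 = [:: emb (false :: w)].
Proof.
have [IH0 _ _] : [/\ stripl L0 (emb w) L0 = [:: L0 :: emb w],
    stripl L10 (emb w) L0 = [:: L1 :: emb w] & stripl L1 (emb w) L0 = [::]].
  elim: w => [|b w [IH0 IHX IH1]] //.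
  by case: b; rewrite /= -!/(emb w) !(IH0, IHX, IH1).
exact: IH0.
Qed.

(** By [stripl_00] an innermost strip with both end labels 0 only puts a 0 in front of the base, so
    it can be absorbed into the base. *)
Lemma Tr_pad0 beta gamma nu delta :
  Tr beta (false :: gamma) nu (false :: delta) = Tr (false :: beta) gamma nu delta.
Proof.
rewrite /Tr (count_trapl_cons _ _ (emb gamma) _ (emb delta)).
by rewrite stripl_00 big_seq1.
Qed.

Lemma trapl_rcons w gamma g delta d : size gamma = size delta ->
  trapl w (rcons gamma g) (rcons delta d) =
  flatten [seq stripl g w' d | w' <- trapl w gamma delta].
Proof.
elim: gamma delta w => [|g' gamma IH] [|d' delta] w //=.
  move=> _; rewrite cats0.
  by elim: (stripl g w d) => //= x s ->.
case=> sz; rewrite (eq_map (fun v => IH delta v sz)).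
by elim: (stripl g' w d') => //= x s IHs; rewrite IHs map_cat flatten_cat.
Qed.

Lemma emb_rcons w b : emb (rcons w b) = rcons (emb w) (label_of_bool b).
Proof. exact: map_rcons. Qed.

Lemma Tr_rcons_true beta gamma nu delta : size gamma = size delta ->
  Tr beta (rcons gamma true) nu (rcons delta true) =
  (\sum_(w <- trapl (emb beta) (emb gamma) (emb delta)) (emb nu == rcons w L1))%N.
Proof.
move=> sz; rewrite /Tr !emb_rcons trapl_rcons ?size_emb //.
rewrite count_flatten -map_comp sumnE big_map.
by apply: eq_bigr => w _ /=; rewrite -/(cst _ _ _ _) cst_11.
Qed.

Lemma Tr_pad1 beta gamma nu delta : size gamma = size delta ->
  Tr beta (rcons gamma true) (rcons nu true) (rcons delta true) =
  Tr beta gamma nu delta.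
Proof.
move=> sz; rewrite Tr_rcons_true // -[RHS]mul1n -(@sum_eq_countN _ _ _ true).
by apply: eq_bigr => w _; rewrite emb_rcons eqseq_rcons eqxx andbT eq_sym.
Qed.

(** * Generation of words by vertical strips *)

Lemma zeros_cat v w : zeros (v ++ w) = (zeros v + zeros w)%N.
Proof. exact: count_cat. Qed.
Lemma ones_cat v w : ones (v ++ w) = (ones v + ones w)%N.
Proof. exact: count_cat. Qed.
Lemma zeros_nseq m b : zeros (nseq m b) = (~~ b * m)%N.
Proof. by rewrite /zeros count_nseq; case: b. Qed.
Lemma ones_nseq m b : ones (nseq m b) = (b * m)%N.
Proof. by rewrite /ones count_nseq; case: b. Qed.

Lemma deg_cat v w : deg (v ++ w) = (deg v + ones v * zeros w + deg w)%N.
Proof.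
elim: v => //= b v ->; rewrite zeros_cat ones_cons; nia.
Qed.

Lemma deg_nseq m b : deg (nseq m b) = 0%N.
Proof. by elim: m => //= m ->; rewrite zeros_nseq; case: b. Qed.

Lemma deg_vac p q : deg (vac p q) = 0%N.
Proof. by rewrite deg_cat !deg_nseq ones_nseq mul0n. Qed.

Lemma zeros_vac p q : zeros (vac p q) = p.
Proof. by rewrite zeros_cat !zeros_nseq /= mul1n addn0. Qed.
Lemma ones_vac p q : ones (vac p q) = q.
Proof. by rewrite ones_cat !ones_nseq /= mul1n. Qed.

Fixpoint binary (w : seq bool) : nat :=
  if w is b :: w' then (b * 2 ^ size w' + binary w')%N else 0%N.

Lemma binary_lt w : (binary w < 2 ^ size w)%N.
Proof. elim: w => //= b w IH; rewrite expnS; case: b; lia. Qed.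

Lemma binary_cat v w : binary (v ++ w) = (binary v * 2 ^ size w + binary w)%N.
Proof. elim: v => //= b v ->; rewrite size_cat expnD; nia. Qed.

Lemma binary_gt0 w : (0 < ones w)%N -> (0 < binary w)%N.
Proof.
elim: w => //= b w IH; rewrite ones_cons; case: b => /= [_|/IH //].
by rewrite mul1n addn_gt0 expn_gt0.
Qed.

Lemma hop_nseq1 m y : hop false (nseq m true) y -> y = nseq m true.
Proof. by elim: m y => [|m IH] [|c y] //=; case: c => //= /IH ->. Qed.

(* Moving the first [ones v] letters 1 gives the largest binary number. *)
Lemma hop_binary b v m y : hop b (b :: v ++ nseq m true) y ->
  (deg y + b * zeros y = deg (b :: v ++ nseq m true) + b + ones v)%N ->
  y != v ++ false :: nseq m true ->
  (binary y < binary (v ++ false :: nseq m true))%N.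
Proof.
elim: v b y => [|d v IH] b [|c y] //.
  rewrite [hop _ _ _]/= cat0s => h.
  have {h}h : hop c (nseq m true) y by case: b h.
  have [le _] := hopw_deg (1 : int) h; have z := hop_zeros h.
  case: c h le z => [h le z e|/hop_nseq1 ->]; last by rewrite eqxx.
  move: e le z; rewrite [deg (true :: y)]/= [deg (b :: _)]/= zeros_cons.
  by rewrite deg_nseq zeros_nseq /= -[ones [::]]/0%N; case: b => /=; lia.
have -> : hop b (b :: (d :: v) ++ nseq m true) (c :: y) =
  hop c (d :: v ++ nseq m true) y by case: b.
move=> h e ne; have z := hop_zeros h; have [le _] := hopw_deg (1 : int) h.
have sz : size y = size (v ++ false :: nseq m true).
  by rewrite -(hop_size h) /= !size_cat /= addnS.
have [dc|dc] := boolP (d == c).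
  rewrite -(eqP dc) in h e ne z le *.
  rewrite /= sz ltn_add2l; apply: IH h _ _; last first.
    by rewrite /= eqseq_cons eqxx in ne.
  move: e z; rewrite [deg (d :: y)]/= [deg (b :: _)]/= !zeros_cons ones_cons.
  by case: b; case: (d) => /=; lia.
have [-> ->] : c = false /\ d = true.
  by move: dc h; case: (c); case: (d); case: (y).
rewrite /=; by rewrite mul0n mul1n add0n; apply: ltn_addr; rewrite -sz binary_lt.
Qed.

Lemma word_split w : {m | w = nseq m true} +
  {vm : seq bool * nat | w = vm.1 ++ false :: nseq vm.2 true}.
Proof.
elim: w => [|b w [[m ->]|[[v m] ->]]]; first by left; exists 0%N.
  case: b; first by left; exists m.+1.
  by right; exists ([::], m).
by right; exists (b :: v, m).
Qed.

Lemma ones0_nseq v : ones v = 0%N -> v = nseq (size v) false.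
Proof. by elim: v => //= -[] v IH; rewrite ones_cons //= => /IH <-. Qed.

(** For [b] false: taking the last 0 of the word [v ++ false :: nseq m true] to the front removes
    the first column of its partition, with one box for each of the [ones v] nonzero parts. *)
Lemma hop_shift b v m : hop b (b :: v ++ nseq m true) (v ++ false :: nseq m true).
Proof.
elim: v b => [|c v IH] b.
  have h : hop false (nseq m true) (nseq m true) by elim: m.
  by case: b.
by case: b (IH c).
Qed.

Lemma deg_shift v m : deg (v ++ false :: nseq m true) =
  (deg (false :: v ++ nseq m true) + ones v)%N.
Proof.
rewrite /= !deg_cat zeros_cons /= deg_nseq zeros_nseq; nia.
Qed.

(* The terms y of the sum in [f_hop] are [v ++ false :: nseq m true] and words of
   smaller binary value, on which f vanishes by induction. *)
Section WordInd.
Variables (M : zmodType) (I : Type) (ok : I -> seq bool -> Prop).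
Variable f : I -> seq bool -> M.

Hypothesis f_vac : forall i p q, ok i (vac p q) -> f i (vac p q) = 0.
Hypothesis ok_deg : forall i x y, size x = size y -> ones x = ones y ->
  deg x = deg y -> ok i x -> ok i y.
Hypothesis f_hop : forall i v m, let x := false :: v ++ nseq m true in
  ok i (v ++ false :: nseq m true) -> (forall j, ok j x -> f j x = 0) ->
  \sum_(y <- words (size x) | hop false x y && (deg y - deg x == ones v)%N)
    f i y = 0.

Lemma word_ind i w : ok i w -> f i w = 0.
Proof.
have [n] := ubnP (binary w); elim: n w i => // n IHn w i.
case: (word_split w) => [[m ->] _|[[v m] ->] /=]; first exact: (f_vac (p := 0)).
rewrite ltnS => lt_n okw.
have [v0|v1] := posnP (ones v).
  have E : v ++ false :: nseq m true = vac (size v).+1 m.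
    rewrite (ones0_nseq v0) /vac size_nseq.
    by elim: (size v) => //= k ->.
  by rewrite E; apply: f_vac; rewrite -E.
set x := false :: v ++ nseq m true.
have sx : size (v ++ false :: nseq m true) = size x by rewrite /x /= !size_cat addnS.
have hw : hop false x (v ++ false :: nseq m true) by apply: hop_shift.
have IHx j : ok j x -> f j x = 0.
  apply: IHn; apply: leq_trans lt_n; rewrite /x /= mul0n add0n !binary_cat /=.
  by have := binary_gt0 v1; rewrite expnS mul0n add0n; have := expn_gt0 2 (size (nseq m true)); nia.
rewrite -(f_hop okw IHx) -/x (@big_words_pick _ _ _ _ (v ++ false :: nseq m true)) //.
  by rewrite hw deg_shift -/x addKn eqxx.
move=> y _ /andP[hy /eqP dy] ne.
have le := hop_deg hy.
have dyw : deg y = deg (v ++ false :: nseq m true).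
  by rewrite deg_shift -/x -dy subnKC.
apply: IHn; last first.
  apply: ok_deg okw => //; first by rewrite sx (hop_size hy).
  by have := hop_ones hy; have := hop_ones hw; rewrite !add0n => <- <-.
apply: leq_trans lt_n; apply: hop_binary hy _ ne.
by rewrite mul0n !addn0 -/x -dy subnKC.
Qed.

End WordInd.

(** The relation [Tr_hop_r] is homogeneous: a strip of size r on [nu] is shared between [beta] and
    [gamma]. So a term of wrong degree reduces to terms of wrong degree, down to the sorted word. *)
Lemma Tr_graded beta gamma nu delta :
  size gamma = size delta -> size nu = (size beta + size gamma)%N ->
  ones nu = (ones beta + ones gamma)%N -> Tr beta gamma nu delta != 0%N ->
  (deg beta + deg delta = deg gamma + deg nu)%N.
Proof.
pose ok (i : seq bool * seq bool * seq bool) nu :=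
  let: (beta, gamma, delta) := i in
  [/\ size gamma = size delta, size nu = (size beta + size gamma)%N &
      ones nu = (ones beta + ones gamma)%N].
pose gr (i : seq bool * seq bool * seq bool) nu :=
  let: (beta, gamma, delta) := i in
  (deg beta + deg delta == deg gamma + deg nu)%N.
(* Declared 0 where the degrees match, so that the vanishing given by [word_ind] is the claim. *)
pose f (i : seq bool * seq bool * seq bool) nu : int :=
  let: (beta, gamma, delta) := i in
  if gr i nu then 0 else (Tr beta gamma nu delta)%:R.
suff f0 i w : ok i w -> f i w = 0.
  move=> sgd snu onu; have := f0 (beta, gamma, delta) nu (And3 sgd snu onu).
  rewrite /f; case: ifP => [/eqP //|_ /eqP]; rewrite Num.Theory.pnatr_eq0.
  by move=> ->.
apply: word_ind => {i w}.
- move=> [[b g] d] p q [sgd snu onu]; rewrite /f /gr.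
  case: ifP => // /negbT; rewrite deg_vac => ne.
  have qg : (ones g <= q)%N by rewrite -(ones_vac p q) onu leq_addl.
  have pg : (zeros g <= p)%N.
    by have := zerosDones b; have := zerosDones g; rewrite size_vac ones_vac in snu onu; lia.
  have := Tr_vac b (p - zeros g) (q - ones g) sgd; rewrite !subnKC // => ->.
  case: eqP => //= gd; case: eqP => //= bv.
  by rewrite bv gd deg_vac addn0 eqxx in ne.
- by move=> [[b g] d] x y sxy oxy dxy [*]; split; rewrite -?sxy -?oxy.
move=> [[b g] d] v m x [sgd snu onu] IH.
have sx : size x = (size b + size g)%N by rewrite -snu /x /= !size_cat addnS.
have ox : ones x = (ones b + ones g)%N.
  by rewrite -onu /x ones_cons !ones_cat ones_cons.
have [e|ne] := boolP (deg b + deg d == deg g + (deg x + ones v))%N.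
  rewrite big1 // => y /andP[h /eqP dy]; rewrite /f /gr.
  by rewrite -(subnKC (hop_deg h)) dy e.
rewrite (eq_bigr (fun y => (Tr b g y d)%:R)) => [|y /andP[h /eqP dy]]; last first.
  by rewrite /f /gr -(subnKC (hop_deg h)) dy (negPf ne).
rewrite -natr_sum (Tr_hop_r _ sgd sx) natr_sum big1 // => b' _.
rewrite natr_sum big1 // => g' /and3P[hb hg /eqP dd].
have := IH (b', g', d); rewrite /f /gr /= => IH'.
have {IH'} := IH' _; case: ifP => [/eqP e _|_ -> //].
  have {}e : (deg b' + deg d = deg g' + deg x)%N := e.
  by have lb := hop_deg hb; have lg := hop_deg hg; case/eqP: ne; lia.
have := hop_ones hb; have := hop_ones hg; rewrite !add0n => <- ->.
by rewrite -(hop_size hg) (hop_size hb).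
Qed.

(** * Pieri rule for alternants *)

(** The position of a 1 counted from the right is its part plus the number of later 1s, that is, its
    exponent in the alternant of lam + staircase. *)
Fixpoint exps (w : seq bool) : seq nat :=
  if w is b :: w' then if b then size w' :: exps w' else exps w' else [::].

Lemma size_exps w : size (exps w) = ones w.
Proof. by elim: w => //= -[] w IH; rewrite ones_cons /= IH. Qed.

Section Alternants.
Variables (k : nat) (R : comNzRingType) (x : 'I_k -> R) (t : R).

Definition det_fun (fs : seq ('I_k -> R)) : R :=
  \det (\matrix_(j < k, i < k) nth (fun=> 0) fs j i).

Definition det_exp (es : seq nat) : R :=
  \det (\matrix_(i < k, j < k) x i ^+ nth 0%N es j).

Definition pw (e : nat) (i : 'I_k) : R := x i ^+ e.
Definition tw (e : nat) (i : 'I_k) : R := (1 + t * x i) * x i ^+ e.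

Lemma det_fun_pw es : size es = k -> det_fun (map pw es) = det_exp es.
Proof.
move=> sz; rewrite /det_exp -det_tr; congr (\det _); apply/matrixP => j i.
by rewrite !mxE (nth_map 0%N) // sz.
Qed.

Lemma det_fun_tw es : size es = k ->
  det_fun (map tw es) = \prod_i (1 + t * x i) * det_exp es.
Proof.
move=> sz; rewrite -det_fun_pw // /det_fun.
pose d : 'rV[R]_k := \row_i (1 + t * x i).
have -> : \prod_i (1 + t * x i) = \det (diag_mx d).
  by rewrite det_diag; apply: eq_bigr => i _; rewrite mxE.
rewrite mulrC -det_mulmx; congr (\det _); apply/matrixP => j i.
by rewrite mul_mx_diag !mxE !(nth_map 0%N) ?sz // mulrC.
Qed.

(** Linearity of the determinant in one row, since (1 + t x) x^e = x^e + t x^(e+1). *)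
Lemma det_fun_lin pre e s : (size pre < k)%N ->
  det_fun (pre ++ tw e :: s) =
  det_fun (pre ++ pw e :: s) + t * det_fun (pre ++ pw e.+1 :: s).
Proof.
move=> lt_k; pose j0 := Ordinal lt_k.
rewrite -[X in X + _]mul1r; apply: (determinant_multilinear (i0 := j0)).
- apply/rowP => i; rewrite !mxE !nth_cat ltnn subnn /= /tw /pw exprS.
  by rewrite mul1r mulrDl mul1r mulrA.
- apply/matrixP => j i; rewrite !mxE !nth_cat; case: ltngtP (neq_lift j0 j) => //=.
    by move=> lt; rewrite -[(_ - _)%N]prednK // subn_gt0.
  by move=> e0 /negP[]; apply/eqP/val_inj; exact/esym.
- apply/matrixP => j i; rewrite !mxE !nth_cat; case: ltngtP (neq_lift j0 j) => //=.
    by move=> lt; rewrite -[(_ - _)%N]prednK // subn_gt0.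
  by move=> e0 /negP[]; apply/eqP/val_inj; exact/esym.
Qed.

Fixpoint choices (es : seq nat) (K : seq nat -> R) : R :=
  if es is e :: s then
    choices s (fun l => K (e :: l)) + t * choices s (fun l => K (e.+1 :: l))
  else K [::].

Lemma eq_choices es K K' : (forall l, K l = K' l) -> choices es K = choices es K'.
Proof.
elim: es K K' => //= e s IH K K' E.
by congr (_ + _ * _); apply: IH => l; rewrite E.
Qed.

Lemma choices_size es K K' : (forall l, size l = size es -> K l = K' l) ->
  choices es K = choices es K'.
Proof.
elim: es K K' => [|e s IH] K K' E /=; first exact: E.
by congr (_ + _ * _); apply: IH => l sl; rewrite E //= sl.
Qed.

Lemma det_fun_choices pre es : (size pre + size es)%N = k ->
  det_fun (map pw pre ++ map tw es) = choices es (fun l => det_exp (pre ++ l)).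
Proof.
elim: es pre => [|e s IH] pre /= sz.
  by rewrite !cats0 det_fun_pw // -sz addn0.
rewrite det_fun_lin; last by rewrite size_map -sz -addn1 leq_add2l.
have cat1 e' (s' : seq ('I_k -> R)) : map pw pre ++ pw e' :: s' = map pw (rcons pre e') ++ s'.
  by rewrite map_rcons cat_rcons.
rewrite !cat1 !IH ?size_rcons ?addSnnS //.
by congr (_ + _ * _); apply: eq_choices => l; rewrite cat_rcons.
Qed.

Definition hopsum a w (K : seq nat -> R) : R :=
  \sum_(y <- words (size w)) hopw t a w y * K (exps y).

Lemma hopsum0 a w K : (forall l, K l = 0) -> hopsum a w K = 0.
Proof. by move=> K0; rewrite /hopsum big1 // => y _; rewrite K0 mulr0. Qed.

Lemma hopsum_cons a b w K : hopsum a (b :: w) K =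
  if b then
    if a then hopsum false w K + t * hopsum true w (fun l => K (size w :: l))
    else hopsum false w (fun l => K (size w :: l))
  else if a then 0 else
    hopsum false w K + t * hopsum true w (fun l => K (size w :: l)).
Proof.
have E c (G : seq bool -> R) : \sum_(y <- words (size w)) c * G y * K (exps (true :: y))
    = c * \sum_(y <- words (size w)) G y * K (size w :: exps y).
  rewrite big_distrr; apply: eq_big_words => y sy /=.
  by rewrite sy mulrA.
rewrite /hopsum [words _]/(words (size w).+1) big_wordsS /=.
case: b; case: a => /=.
- by rewrite E expr1; congr (_ + _); apply: eq_bigr => y _; rewrite expr0 mul1r.
- rewrite big1 ?add0r => [|y _]; last by rewrite !mul0r.
  by rewrite E mul1r.
- by rewrite !big1 ?addr0 // => y _; rewrite !mul0r.
- congr (_ + _); first by apply: eq_bigr => y _; rewrite expr0 !mul1r.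
  by rewrite -E; apply: eq_bigr => y _; rewrite mul1r expr1.
Qed.

(* Terms in which a letter 1 is caught up by the next one have two equal
   exponents and vanish. *)
Lemma choices_exps w K : (forall pre e s, K (pre ++ e :: e :: s) = 0) ->
  choices (exps w) K =
  hopsum false w K + t * hopsum true w (fun l => K (size w :: l)).
Proof.
elim: w K => [|b w IH] K K0.
  by rewrite /hopsum !big_words0 /= mul0r mulr0 addr0 mul1r.
have K0' e pre e' s : K (e :: pre ++ e' :: e' :: s) = 0 by rewrite -cat_cons K0.
rewrite !hopsum_cons; case: b; rewrite /= ?mulr0 ?addr0; last by rewrite IH.
rewrite !IH // [hopsum true w (fun l => K (size w :: size w :: l))]hopsum0.
  by rewrite mulr0 addr0.
by move=> l; apply: (K0 [::]).
Qed.

Lemma det_exp_eq0 pre e s : size (pre ++ e :: e :: s) = k ->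
  det_exp (pre ++ e :: e :: s) = 0.
Proof.
rewrite size_cat /= => sz.
have lt1 : (size pre < k)%N by rewrite -sz !addnS ltnS leqW ?leq_addr.
have lt2 : ((size pre).+1 < k)%N by rewrite -sz !addnS !ltnS leq_addr.
rewrite /det_exp -det_tr.
apply: (determinant_alternate (i1 := Ordinal lt1) (i2 := Ordinal lt2)).
  by rewrite -val_eqE /= neq_ltn leqnn.
by move=> i; rewrite !mxE !nth_cat ltnn subnn /= ltnNge leqnSn /= subSnn.
Qed.

(** Multiplying all rows by 1 + t x_i raises every subset of the exponents by one. The leading 0
    leaves [exps] unchanged but gives the largest exponent room to grow within the word. *)
Lemma pieri_exp w : ones w = k ->
  \prod_i (1 + t * x i) * det_exp (exps (false :: w)) =
  \sum_(y <- words (size w).+1) hopw t false (false :: w) y * det_exp (exps y).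
Proof.
(* [choices_exps] wants vanishing on all lists with two equal neighbours, while [det_exp_eq0] gives
   it only for lists of length k; the other lists are cut off. *)
move=> wk; pose K es := if size es == k then det_exp es else 0.
have sz : size (exps w) = k by rewrite size_exps.
rewrite -det_fun_tw // -[map _ _]cat0s (@det_fun_choices [::]) //=.
rewrite (@choices_size _ _ K) => [|l sl]; last by rewrite /K sl sz eqxx.
rewrite choices_exps => [|pre e s]; last first.
  by rewrite /K; case: eqP => // /det_exp_eq0.
transitivity (hopsum false (false :: w) K); first by rewrite hopsum_cons.
apply: eq_bigr => y _; rewrite -[X in _ = X * _]/(hopw t false (false :: w) y).
rewrite !hopwE; case: (boolP (hop _ _ _)) => [h|_]; last by rewrite !mul0r.
have := hop_ones h; rewrite !add0n ones_cons wk -size_exps => e.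
by rewrite /K -e eqxx.
Qed.

End Alternants.

(** * Schur polynomials of words *)

Lemma size_parts w : size (parts w) = ones w.
Proof. by elim: w => //= -[] w IH; rewrite ones_cons /= IH. Qed.

Lemma nth_exps w j : (j < ones w)%N ->
  nth 0%N (exps w) j = (nth 0%N (parts w) j + (ones w - j.+1))%N.
Proof.
elim: w j => [|[] w IH] j //=; rewrite ones_cons /=; last exact: IH.
case: j => [_|j lt]; last by rewrite /= IH.
by rewrite /= add1n subn1 /= zerosDones.
Qed.

Lemma leq_nth_parts w i : (nth 0 (parts w) i <= zeros w)%N.
Proof.
elim: w i => [|[] w IH] i /=; first by rewrite nth_nil.
  by case: i => [|i] /=; rewrite zeros_cons.
by rewrite zeros_cons (leq_trans (IH i)) // leq_addl.
Qed.

Lemma parts_sorted w i j : (i <= j)%N -> (nth 0 (parts w) j <= nth 0 (parts w) i)%N.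
Proof.
elim: w i j => [|[] w IH] i j; rewrite ?nth_nil //=; last exact: IH.
case: i j => [|i] [|j] //= le; last exact: IH.
exact: leq_nth_parts.
Qed.

Lemma parts_inj w w' : size w = size w' -> ones w = ones w' ->
  parts w = parts w' -> w = w'.
Proof.
have aux v v' : size v = size v' -> ones (true :: v) = ones (false :: v') ->
  zeros v :: parts v = parts v' -> False.
  rewrite !ones_cons => s o e; have := leq_nth_parts v' 0; rewrite -e /=.
  by have := zerosDones v; have := zerosDones v'; lia.
elim: w w' => [|b w IH] [|b' w'] //= [s]; case: b; case: b' => // o.
- by case=> _ /(IH w' s) ->; move: o; rewrite !ones_cons // => -[].
- by move=> e; case: (aux w w' s o e).
- by move=> e; case: (aux w' w (esym s) (esym o) (esym e)).
- by move: o; rewrite !ones_cons => o /(IH w' s o) ->.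
Qed.

Lemma parts_pad0 n w : parts (nseq n false ++ w) = parts w.
Proof. by elim: n. Qed.

Section Schur.
Variable k : nat.
Local Notation P := {mpoly int[k]}.
Local Notation F := {fraction {mpoly int[k]}}.
Implicit Types (w : seq bool).

Definition alt w : P := det_exp (fun i : 'I_k => 'X_i : P) (exps w).

Lemma alternant_partition w : ones w = k ->
  alternant (partition_of k w + staircase k)%MM = alt w.
Proof.
move=> wk; congr (\det _); apply/matrixP => i j; rewrite !mxE; congr (_ ^+ _).
by rewrite mnmDE !mnmE nth_exps wk.
Qed.

Definition elem (r : nat) : P :=
  (\prod_(i < k) (1 + 'X * ('X_i : P)%:P) : {poly P})`_r.

Lemma pieri_alt r w : ones w = k ->
  elem r * alt (false :: w) =
  \sum_(y <- words (size w).+1 |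
      hop false (false :: w) y && (deg y - deg (false :: w) == r)%N) alt y.
Proof.
move=> wk.
have detP es : det_exp (fun i : 'I_k => ('X_i : P)%:P) es =
    (det_exp (fun i : 'I_k => 'X_i : P) es)%:P.
  rewrite /det_exp -det_map_mx; congr (\det _).
  by apply/matrixP => i j; rewrite !mxE rmorphXn.
have := pieri_exp (fun i : 'I_k => ('X_i : P)%:P) 'X wk.
move/(congr1 (fun p : {poly P} => p`_r)); rewrite detP coefMC coef_sum.
rewrite -/(elem r) -/(alt _) => ->; rewrite [RHS]big_mkcond.
apply: eq_bigr => y _; rewrite hopwE detP coefMC -/(alt y).
rewrite -polyC_natr coefCM coefXn eq_sym.
by case: hop; case: eqP; rewrite /= ?mul1r ?mul0r ?mulr0.
Qed.

(** A strictly increasing map satisfies i <= u i; this is applied to s and to its inverse. *)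
Lemma incr_perm (s : 'S_k) : (forall i j : 'I_k, (i < j)%N -> (s i < s j)%N) -> s = 1%g.
Proof.
move=> s_incr.
have ge (u : 'S_k) : (forall i j : 'I_k, (i < j)%N -> (u i < u j)%N) ->
    forall i : 'I_k, (i <= u i)%N.
  move=> u_incr i; case: i => n; elim: n => [|n IH] // nk.
  have nk' : (n < k)%N by apply: ltnW.
  by apply: leq_ltn_trans (IH nk') _; apply: u_incr.
have s'_incr (i j : 'I_k) : (i < j)%N -> ((s^-1)%g i < (s^-1)%g j)%N.
  move=> ij; rewrite ltnNge; apply/negP; rewrite leq_eqVlt => /orP[/eqP/val_inj/perm_inj e|/s_incr].
    by rewrite e ltnn in ij.
  by rewrite !permKV ltnNge ltnW.
apply/permP => i; rewrite perm1; apply/val_inj/eqP; rewrite eqn_leq ge // andbT.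
by have := ge _ s'_incr (s i); rewrite permK.
Qed.

(** Among the monomials of an alternant with decreasing exponents only that of the identity
    permutation is again decreasing. These coefficients separate alternants, which gives the linear
    independence of Schur polynomials. *)
Lemma mcoeff_alternant (al be : 'X_{1..k}) :
  (forall i j : 'I_k, (i < j)%N -> (al j < al i)%N) ->
  (forall i j : 'I_k, (i < j)%N -> (be j < be i)%N) ->
  (alternant al)@_be = (al == be)%:R.
Proof.
move=> al_decr be_decr; rewrite /alternant /determinant raddf_sum /=.
have term (s : 'S_k) : ((-1) ^+ s * \prod_i (\matrix_(i, j) 'X_i ^+ al j) i (s i) : P)@_be =
    (-1) ^+ s * ([multinom al (s i) | i < k] == be)%:R.
  have -> : (-1) ^+ s = ((-1) ^+ s)%:MP :> P by rewrite rmorphXn rmorphN1.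
  rewrite mcoeffCM; congr (_ * _).
  rewrite -mcoeffX mpolyXE_id; congr (_@_ _).
  by apply: eq_bigr => i _; rewrite !mxE mnmE.
under eq_bigr do rewrite term.
rewrite (bigD1 (1%g : 'S_k)) //= [X in _ + X]big1 ?addr0 => [|s s1].
  rewrite odd_perm1 mul1r; congr ((_ == _)%:R).
  by apply/mnmP => i; rewrite mnmE perm1.
case: eqP => [e|]; rewrite ?mulr0 //; case/eqP: s1; apply: incr_perm => i j ij.
have sE l : be l = al (s l) by rewrite -e mnmE.
rewrite ltnNge; apply/negP; rewrite leq_eqVlt => /orP[/eqP/val_inj/perm_inj ji|/al_decr].
  by rewrite ji ltnn in ij.
by rewrite -!sE ltnNge ltnW // be_decr.
Qed.

Lemma staircase_decr (lam : 'X_{1..k}) : is_partition lam ->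
  forall i j : 'I_k, (i < j)%N -> ((lam + staircase k)%MM j < (lam + staircase k)%MM i)%N.
Proof.
move=> /forallP lamP i j ij; have /forallP/(_ j)/implyP/(_ (ltnW ij)) := lamP i.
by rewrite !mnmDE !mnmE; have := ltn_ord j; lia.
Qed.

Lemma alternant_staircase_neq0 : alternant (staircase k) != 0.
Proof.
have decr (i j : 'I_k) : (i < j)%N -> (staircase k j < staircase k i)%N.
  by move=> ij; rewrite !mnmE; have := ltn_ord j; lia.
apply/eqP => /(congr1 (mcoeff (staircase k))).
by rewrite mcoeff_alternant // eqxx mcoeff0.
Qed.

Lemma schur_mul lam : schur lam * tofrac (alternant (staircase k)) =
  tofrac (alternant (lam + staircase k)%MM).
Proof.
by rewrite /schur divfK // tofrac_eq0 alternant_staircase_neq0.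
Qed.

(** Linear independence, stated for two expansions over unrelated index types. Multiplying by the
    staircase alternant leads back to polynomials, where the coefficient at kappa + staircase is
    compared. *)
Lemma schur_coef (I J : Type) (r : seq I) (p : pred I) (c : I -> int) (f : I -> 'X_{1..k})
    (s : seq J) (q : pred J) (d : J -> int) (g : J -> 'X_{1..k}) kappa :
  (forall i, p i -> is_partition (f i)) -> (forall j, q j -> is_partition (g j)) ->
  is_partition kappa ->
  \sum_(i <- r | p i) (c i)%:~R * schur (f i) =
  \sum_(j <- s | q j) (d j)%:~R * schur (g j) ->
  \sum_(i <- r | p i) c i * (f i == kappa)%:R =
  \sum_(j <- s | q j) d j * (g j == kappa)%:R.
Proof.
move=> fP gP kP.
have coef (L : Type) (l : seq L) (pl : pred L) (cl : L -> int) (h : L -> 'X_{1..k}) :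
   (forall i, pl i -> is_partition (h i)) ->
   let A := \sum_(i <- l | pl i) (cl i)%:~R * alternant (h i + staircase k)%MM in
   (\sum_(i <- l | pl i) (cl i)%:~R * schur (h i)) * tofrac (alternant (staircase k)) = tofrac A
   /\ A@_(kappa + staircase k)%MM = \sum_(i <- l | pl i) cl i * (h i == kappa)%:R.
  move=> hP A; rewrite /A; split.
    rewrite mulr_suml [RHS]rmorph_sum; apply: eq_bigr => i _ /=.
    by rewrite -mulrA schur_mul rmorphM /= rmorph_int.
  rewrite raddf_sum /=; apply: eq_bigr => i pi.
  have -> : (cl i)%:~R = (cl i)%:MP :> P by rewrite -[in RHS](intz (cl i)) rmorph_int.
  rewrite mcoeffCM mcoeff_alternant; [|exact/staircase_decr/hP|exact: staircase_decr].
  by rewrite (inj_eq (@addIm _ _)).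
move=> E; have [Ef <-] := coef _ r p c f fP; have [Eg <-] := coef _ s q d g gP.
by congr (_@_ _); apply/eqP; rewrite -tofrac_eq -Ef -Eg E.
Qed.

Definition sch w : F := schur (partition_of k w).

Lemma sch_mul w : ones w = k ->
  sch w * tofrac (alternant (staircase k)) = tofrac (alt w).
Proof. by move=> wk; rewrite schur_mul alternant_partition. Qed.

Lemma is_partition_of w : is_partition (partition_of k w).
Proof.
apply/forallP => i; apply/forallP => j; apply/implyP => ij.
by rewrite !mnmE parts_sorted.
Qed.

Lemma partition_of_inj w w' : ones w = k -> ones w' = k -> size w = size w' ->
  partition_of k w = partition_of k w' -> w = w'.
Proof.
move=> wk w'k sz e; apply: parts_inj; rewrite ?wk //.
apply: (@eq_from_nth _ 0%N); rewrite !size_parts ?wk // => i ik.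
have := congr1 (fun m : 'X_{1..k} => m (Ordinal ik)) e.
by rewrite !mnmE.
Qed.

Lemma pieri r w : ones w = k ->
  tofrac (elem r) * sch (false :: w) =
  \sum_(y <- words (size w).+1 |
      hop false (false :: w) y && (deg y - deg (false :: w) == r)%N) sch y.
Proof.
move=> wk; apply: (@mulIf _ (tofrac (alternant (staircase k)))).
  by rewrite tofrac_eq0 alternant_staircase_neq0.
rewrite -mulrA sch_mul // -rmorphM pieri_alt // rmorph_sum mulr_suml.
apply: eq_bigr => y /andP[/hop_ones + _]; rewrite add0n => e.
by rewrite sch_mul // -e.
Qed.

Lemma sch_vac p : sch (vac p k) = 1.
Proof.
have st : alternant (partition_of k (vac p k) + staircase k)%MM = alternant (staircase k).
  congr (alternant _); apply/mnmP => i; rewrite mnmDE mnmE.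
  suff -> : nth 0%N (parts (vac p k)) i = 0%N by [].
  rewrite parts_pad0; elim: k (nat_of_ord i) => [|m IH] j; first by rewrite nth_nil.
  by case: j => [|j] /=; rewrite ?zeros_nseq ?IH.
rewrite /sch /schur st divff // tofrac_eq0 alternant_staircase_neq0 //.
Qed.

Lemma sch_free n (c d : seq bool -> int) :
  \sum_(w <- words n | ones w == k) (c w)%:~R * sch w =
  \sum_(w <- words n | ones w == k) (d w)%:~R * sch w ->
  forall w, size w = n -> ones w = k -> c w = d w.
Proof.
move=> E w wn wk.
have pick (h : seq bool -> int) : \sum_(v <- words n | ones v == k)
    h v * (partition_of k v == partition_of k w)%:R = h w.
  rewrite (@big_words_pick _ _ _ _ w) ?wk ?eqxx ?mulr1 // => v vn /eqP vk ne.
  case: eqP => [e|_]; last by rewrite mulr0.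
  by case/eqP: ne; apply: partition_of_inj e; rewrite ?vn.
rewrite -pick -[RHS]pick.
by apply: schur_coef E => *; apply: is_partition_of.
Qed.

(** [LR] is some expansion chosen by epsilon; by [schur_coef] every expansion has the same
    coefficients. *)
Lemma LR_unique (c : 'X_{1..k} -> int) lam mu nu : is_partition nu ->
  schur_expansion (schur lam * schur mu) c -> LR lam mu nu = c nu.
Proof.
move=> nuP cE; have := ClassicalEpsilon.epsilon_spec (inhabits (fun=> 0)) _ (ex_intro _ c cE).
rewrite -/(LR lam mu); case: cE => [N [cN E]] [N' [LN' E']].
have pick (M : nat) (h : 'X_{1..k} -> int) :
    (forall nu, h nu != 0 -> is_partition nu && (mdeg nu < M)%N) ->
    \sum_(m : 'X_{1..k < M} | is_partition m) h m * (bmnm m == nu)%:R = h nu.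
  move=> hM; have [h0|/hM/andP[_ lt]] := eqVneq (h nu) 0.
    rewrite h0 big1 // => m _; case: eqP => [->|_]; last by rewrite mulr0.
    by rewrite h0 mul0r.
  rewrite (bigD1 (BMultinom lt)) //= eqxx mulr1 big1 ?addr0 // => m /andP[_ ne].
  case: eqP => [e|_]; last by rewrite mulr0.
  by case/eqP: ne; apply: val_inj.
rewrite -(pick _ _ cN) -(pick _ _ LN').
by apply: schur_coef => //; rewrite -E -E'.
Qed.

Lemma LR_words n (c : seq bool -> int) lam mu nu :
  schur lam * schur mu = \sum_(w <- words n | ones w == k) (c w)%:~R * sch w ->
  size nu = n -> ones nu = k -> LR lam mu (partition_of k nu) = c nu.
Proof.
move=> E nun nuk.
(* The coefficients carried over from words to partitions; no two words are merged, by
   [partition_of_inj]. *)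
pose d (m : 'X_{1..k}) : int :=
  \sum_(w <- words n | ones w == k) c w * (partition_of k w == m)%:R.
have d_nu : d (partition_of k nu) = c nu.
  rewrite /d (@big_words_pick _ _ _ _ nu) ?nuk ?eqxx ?mulr1 // => v vn /eqP vk ne.
  case: eqP => [e|_]; last by rewrite mulr0.
  by case/eqP: ne; apply: partition_of_inj e; rewrite ?vn.
rewrite -d_nu; apply: LR_unique; first exact: is_partition_of.
pose N := (\max_(w <- words n) mdeg (partition_of k w)).+1.
exists N; split=> [m dm|].
  have [w [wn wk wm]] : exists w, [/\ w \in words n, ones w == k & partition_of k w = m].
    case: (boolP (has (fun w => (ones w == k) && (partition_of k w == m)) (words n))).
      by case/hasP => w wn /andP[wk /eqP wm]; exists w.
    move/hasPn => no; case/eqP: dm; rewrite /d big_seq_cond big1 // => w /andP[wn wk].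
    by have := no w wn; rewrite wk /= => /negPf ->; rewrite mulr0.
  rewrite -wm is_partition_of ltnS /=.
  by apply: leq_bigmax_seq.
rewrite E /d.
transitivity (\sum_(m : 'X_{1..k < N} | is_partition m)
   \sum_(w <- words n | ones w == k) ((c w)%:~R * (partition_of k w == m)%:R) * schur m).
  rewrite exchange_big [LHS]big_seq_cond [RHS]big_seq_cond.
  apply: eq_bigr => w /andP[wn wk].
  have lt : (mdeg (partition_of k w) < N)%N.
    rewrite ltnS; by apply: leq_bigmax_seq.
  rewrite (bigD1 (BMultinom lt)) ?is_partition_of //= eqxx mulr1 big1 ?addr0 // => m /andP[_ ne].
  case: eqP => [e|_]; last by rewrite mulr0 mul0r.
  by case/eqP: ne; apply: val_inj.
apply: eq_bigr => m _; rewrite rmorph_sum mulr_suml; apply: eq_bigr => w _ /=.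
by rewrite intrM; case: eqP.
Qed.

End Schur.

(** * Triangular puzzles compute Littlewood-Richardson coefficients *)

Notation hopr r x y := (hop false x y && (deg y - deg x == r)%N).

Notation tri_num g m d := (Tr [::] g m d).

(** A leading 1 would alone contribute [zeros w] to the degree. This is how the degree bounds
    provide the leading 0 that [pieri] needs. *)
Lemma lead0 w : (deg w < zeros w)%N -> {w' | w = false :: w'}.
Proof.
case: w => [|[] w] //=; last by exists w.
by rewrite zeros_cons /= mul1n ltnNge leq_addr.
Qed.

Arguments words n : simpl never.
Arguments hop a x y : simpl never.
Arguments deg w : simpl never.

Lemma Tr_graded_T gamma mu delta : size gamma = size delta ->
  size mu = size gamma -> ones mu = ones gamma -> tri_num gamma mu delta != 0%N ->
  deg delta = (deg gamma + deg mu)%N.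
Proof. by move=> sd sm om; apply: (@Tr_graded [::]). Qed.

(** With an empty base the whole strip passes to [gamma]. On the side of Schur polynomials this is
    e_r s_mu s_gamma, with e_r applied to either factor. *)
Lemma tri_hop r gamma mu delta : size gamma = size delta -> size mu = size gamma ->
  (\sum_(y <- words (size mu) | hopr r mu y) tri_num gamma y delta =
   \sum_(g <- words (size gamma) | hopr r gamma g) tri_num g mu delta)%N.
Proof.
move=> sd sm; have := @Tr_hop_r r [::] gamma mu delta sd sm.
by move=> E; rewrite -[LHS]/(\sum_(y <- words (size mu) | hopr r mu y) _) E big_words0.
Qed.

Section LRTriangle.
Variable k : nat.
Local Notation sch := (@sch k).
Local Notation F := {fraction {mpoly int[k]}}.

(** Induction on [mu] for all [gamma] at once: a strip on [mu] becomes a strip on [gamma], by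
    [pieri] for the product and by [tri_hop] for the puzzles. The degree bound is preserved because
    only the sum of the degrees enters. *)
Lemma sch_triangle n gamma mu : size gamma = n -> size mu = n ->
  ones gamma = k -> ones mu = k -> (deg gamma + deg mu < n - k)%N ->
  sch gamma * sch mu =
  \sum_(d <- words n | ones d == k) (tri_num gamma mu d)%:Z%:~R * sch d.
Proof.
pose ok g m := [/\ size g = n, size m = n, ones g = k, ones m = k &
  (deg g + deg m < n - k)%N].
pose f g m : F := sch g * sch m -
  \sum_(d <- words n | ones d == k) (tri_num g m d)%:Z%:~R * sch d.
suff f0 g m : ok g m -> f g m = 0.
  by move=> *; apply/eqP; rewrite -subr_eq0; apply/eqP/f0.
have zn w : size w = n -> ones w = k -> zeros w = (n - k)%N.
  by move=> <- <-; rewrite -zerosDones addnK.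
apply: (@word_ind _ _ ok) => {g m}.
- move=> g p q [gn pqn gk]; rewrite ones_vac => qk; rewrite /f qk.
  have p_g : p = zeros g by rewrite zn // -pqn size_vac qk addnK.
  move=> _; rewrite sch_vac mulr1 (@big_words_pick _ _ _ _ g) ?gk //.
    have := @Tr_vac [::] g g 0 0 erefl.
    by rewrite !addn0 gk -p_g !eqxx => ->; rewrite mul1r subrr.
  move=> d dn _ ne; have := @Tr_vac [::] g d 0 0 _.
  by rewrite !addn0 gk -p_g gn dn eq_sym (negPf ne) => -> //; rewrite mul0r.
- by move=> g x y sxy oxy dxy [*]; split; rewrite -?sxy -?oxy -?dxy.
move=> g v m x [gn wn gk wk lt] IH.
have xn : size x = n by rewrite -wn /x /= !size_cat addnS.
have vk : ones (v ++ nseq m true) = k by rewrite -wk !ones_cat ones_cons.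
have xk : ones x = k by rewrite /x ones_cons vk.
have dw := deg_shift v m; rewrite -/x in dw.
(* Pieri's rule is needed for [g] as well as for [x], so [g] must also begin with 0. *)
have [g' g_eq] : {g' | g = false :: g'}.
  by apply: lead0; rewrite zn //; apply: leq_ltn_trans lt; rewrite leq_addr.
have g'k : ones g' = k by rewrite -gk g_eq ones_cons.
rewrite big_split sumrN /= -big_distrr /=.
have px := pieri (ones v) vk; rewrite -/x in px; rewrite -px {px}.
have pg := pieri (ones v) g'k; rewrite -g_eq in pg.
rewrite mulrCA mulrA pg mulr_suml.
rewrite -[words (size g').+1]/(words (size (false :: g'))) -g_eq.
transitivity (\sum_(y <- words (size g) | hopr (ones v) g y) f y x); last first.
  rewrite big_seq_cond big1 // => y /and3P[]; rewrite mem_words => /eqP sy hy /eqP dy.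
  apply: IH; split; rewrite ?sy //; first by rewrite -gk (hop_ones hy).
  by move: lt; rewrite dw -dy -(subnKC (hop_deg hy)); lia.
rewrite [RHS]big_split sumrN /=; congr (_ - _).
rewrite exchange_big [RHS]exchange_big big_seq_cond [RHS]big_seq_cond /=.
apply: eq_bigr => d /andP[]; rewrite mem_words => /eqP dn _.
rewrite -!mulr_suml; congr (_ * _).
have := @tri_hop (ones v) g x d; rewrite gn dn => /(_ erefl xn) e.
by rewrite -!rmorph_sum /=; congr (Posz _)%:~R; apply: e.
Qed.

End LRTriangle.

Lemma tri_pad0 N gamma mu delta :
  tri_num (nseq N false ++ gamma) (nseq N false ++ mu) (nseq N false ++ delta) =
  tri_num gamma mu delta.
Proof. by elim: N => //= N <-; rewrite Tr_pad0 Tr_cons0. Qed.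

Lemma deg_pad0 N w : deg (nseq N false ++ w) = deg w.
Proof. by rewrite deg_cat deg_nseq ones_nseq. Qed.
Lemma ones_pad0 N w : ones (nseq N false ++ w) = ones w.
Proof. by rewrite ones_cat ones_nseq. Qed.
Lemma size_pad (T : Type) N (b : T) w : size (nseq N b ++ w) = (N + size w)%N.
Proof. by rewrite size_cat size_nseq. Qed.

(** Putting N letters 0 in front changes neither the partitions nor the puzzle count, and satisfies
    the degree bound of [sch_triangle]. *)
Lemma LR_string_tri gamma mu delta :
  size gamma = size delta -> size mu = size delta ->
  ones gamma = ones delta -> ones mu = ones delta ->
  LR_string gamma mu delta = (tri_num gamma mu delta)%:Z.
Proof.
move=> sg sm og om; rewrite /LR_string; set k := ones delta in og om *.
pose N := (deg gamma + deg mu).+1.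
have pE w : partition_of k (nseq N false ++ w) = partition_of k w.
  by rewrite /partition_of parts_pad0.
rewrite -(pE delta) (@LR_words _ (N + size delta)
  (fun d => (tri_num (nseq N false ++ gamma) (nseq N false ++ mu) d)%:Z)).
- by rewrite tri_pad0.
- rewrite -(pE gamma) -(pE mu).
  apply: sch_triangle; rewrite ?size_pad ?sg ?sm ?ones_pad0 //.
  by rewrite !deg_pad0 /k -(zerosDones delta) addnA addnK ltn_addr.
- exact: size_pad.
- exact: ones_pad0.
Qed.

(** * Commutation of adding and removing vertical strips *)

(** With [hw_next], this writes [hopw] as a product of one-letter transfer matrices, so that sums
    over the middle word can be evaluated letter by letter. *)
Definition hw_weight (R : comNzRingType) (t : R) (a b c : bool) : R :=
  if b then (if a then t ^+ c else c%:R) else (~~ a)%:R * t ^+ c.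
Definition hw_next (a b c : bool) : bool :=
  if b then (if a then c else false) else c.

Lemma hopw_cons (R : comNzRingType) (t : R) a b x c y :
  hopw t a (b :: x) (c :: y) = hw_weight t a b c * hopw t (hw_next a b c) x y.
Proof. by case: a; case: b; rewrite /= /hw_weight /hw_next ?mulrA. Qed.

Section Heisenberg.
Local Notation q := ('X : {poly int}).
Local Notation alpha := (1 - q).

(** [genA] adds a strip and then removes one, [genB] removes first. Only the added strip is marked
    by q; the size of the removed one follows from the degrees of [x] and [z]. *)
Definition genA (a1 a2 : bool) x z : {poly int} :=
  \sum_(y <- words (size x)) hopw q a1 x y * hopw 1 a2 z y.
Definition genB (b1 b2 : bool) x z : {poly int} :=
  \sum_(y <- words (size x)) hopw 1 b1 y x * hopw q b2 y z.

Lemma genA_cons a1 a2 b1 b2 x z : genA a1 a2 (b1 :: x) (b2 :: z) =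
  hw_weight q a1 b1 false * hw_weight 1 a2 b2 false *
    genA (hw_next a1 b1 false) (hw_next a2 b2 false) x z +
  hw_weight q a1 b1 true * hw_weight 1 a2 b2 true *
    genA (hw_next a1 b1 true) (hw_next a2 b2 true) x z.
Proof.
rewrite [LHS](big_wordsS (size x)) [in RHS]/genA.
rewrite [X in _ = X + _]mulr_sumr [X in _ = _ + X]mulr_sumr.
by congr (_ + _); apply: eq_bigr => y _; rewrite !hopw_cons mulrACA.
Qed.

Lemma genB_cons b1 b2 c1 c2 x z : genB b1 b2 (c1 :: x) (c2 :: z) =
  hw_weight 1 b1 false c1 * hw_weight q b2 false c2 *
    genB (hw_next b1 false c1) (hw_next b2 false c2) x z +
  hw_weight 1 b1 true c1 * hw_weight q b2 true c2 *
    genB (hw_next b1 true c1) (hw_next b2 true c2) x z.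
Proof.
rewrite [LHS](big_wordsS (size x)) [in RHS]/genB.
rewrite [X in _ = X + _]mulr_sumr [X in _ = _ + X]mulr_sumr.
by congr (_ + _); apply: eq_bigr => y _; rewrite !hopw_cons mulrACA.
Qed.

Lemma genA_nil a1 a2 : genA a1 a2 [::] [::] = (~~ a1)%:R * (~~ a2)%:R.
Proof. exact: big_words0. Qed.
Lemma genB_nil b1 b2 : genB b1 b2 [::] [::] = (~~ b1)%:R * (~~ b2)%:R.
Proof. exact: big_words0. Qed.

Lemma genA_lead a x z : genA true a (false :: x) z = 0.
Proof. by rewrite /genA big1 // => y _; rewrite hopw_eq0 ?mul0r //; case: y. Qed.

Local Notation h x y := ((hop false x y)%:R : int).
Local Notation hr r x y := ((hopr r x y)%:R : int).

Lemma coef_genA x z r : (genA false false x z)`_r =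
  \sum_(y <- words (size x)) hr r x y * h z y.
Proof.
rewrite coef_sum; apply: eq_bigr => y _.
rewrite !hopwE expr1n mulr1 mulrAC -!natrM -polyC_natr coefCM coefXn eq_sym.
by rewrite -natrM !mulnb andbAC.
Qed.

Lemma coef_genB x z r : (genB false false x z)`_r =
  \sum_(y <- words (size x)) h y x * hr r y z.
Proof.
rewrite coef_sum; apply: eq_bigr => y _.
rewrite !hopwE expr1n mulr1 mulrA -!natrM -polyC_natr coefCM coefXn eq_sym.
by rewrite -natrM !mulnb andbA.
Qed.

Opaque genA genB.

(* genB - alpha * (...) is divisible by q ^+ m on words ending with m letters 1;
   four such combinations are propagated together along the words. *)
Definition err1 x z := genB false false x z
  - alpha * (genA false false x z + q * genA true true x z).
Definition err2 x z := genB true true x z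
  - alpha * (genA false false x z - alpha * genA true true x z).
Definition err3 x z := genB true false x z - alpha * genA false true x z.
Definition err4 x z := genB false true x z - alpha * genA true false x z.

Lemma err_cons b c x z :
  [/\ err1 (b :: x) (c :: z) =
        match b, c with
        | false, false => err1 x z | true, true => err1 x z + q * err2 x z
        | true, false => err3 x z | false, true => q * err4 x z end,
      err2 (b :: x) (c :: z) =
        match b, c with
        | false, false => err1 x z | true, true => q * err2 x z
        | true, false => err3 x z | false, true => q * err4 x z end,
      err3 (b :: x) (c :: z) =
        match b, c with
        | false, false => 0 | true, true => err3 x z
        | true, false => 0 | false, true => err1 x z end &
      err4 (b :: x) (c :: z) =
        match b, c with
        | false, false => 0 | true, true => q * err4 x z
        | true, false => err1 x z | false, true => 0 end].
Proof.
rewrite /err1 /err2 /err3 /err4 !genA_cons !genB_cons.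
by case: b; case: c; rewrite /hw_weight /hw_next /=;
  move: (genA false false x z) (genA false true x z) (genA true false x z)
    (genA true true x z) (genB false false x z) (genB false true x z)
    (genB true false x z) (genB true true x z) => a00 a01 a10 a11 b00 b01 b10 b11;
  split; ring.
Qed.

Lemma err_ones m (w := nseq m true) :
  [/\ err1 w w = q ^+ m.+1, err2 w w = - (alpha * q ^+ m), err3 w w = 0 & err4 w w = 0].
Proof.
rewrite {}/w; elim: m => [|m [IH1 IH2 IH3 IH4]].
  rewrite /err1 /err2 /err3 /err4 !genA_nil !genB_nil expr1 expr0 /=.
  split; ring.
have [-> -> -> ->] := err_cons true true (nseq m true) (nseq m true).
rewrite IH1 IH2 IH3 IH4 !exprS; split; ring.
Qed.

Lemma err_divisible m u v : size u = size v ->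
  let x := u ++ nseq m true in let z := v ++ nseq m true in
  [/\ exists p, err1 x z = q ^+ m * p, exists p, err2 x z = q ^+ m * p,
      exists p, err3 x z = q ^+ m * p & exists p, err4 x z = q ^+ m * p].
Proof.
elim: u v => [|b u IH] [|c v] //= sz.
  have [-> -> -> ->] := err_ones m.
  split; [exists q | exists (- alpha) | exists 0 | exists 0]; rewrite ?exprS; ring.
case: sz => /IH[[p1 e1] [p2 e2] [p3 e3] [p4 e4]].
have [-> -> -> ->] := err_cons b c (u ++ nseq m true) (v ++ nseq m true).
have qp (p : {poly int}) : q * (q ^+ m * p) = q ^+ m * (q * p) by rewrite mulrCA.
rewrite e1 e2 e3 e4 !qp; case: b; case: c; split;
  by [exists 0; rewrite mulr0 | eexists | exists (p1 + q * p2); rewrite mulrDr].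
Qed.

(** Modulo q^m, [genB] is (1 - q) times [genA]: the leading 0 of [x] kills the extra term
    [genA true true]. Dividing by 1 - q turns coefficients into partial sums, whence the sum over j
    <= l. *)
Lemma heisenberg_pad l m u v : (l < m)%N -> (size u).+1 = size v ->
  let x := false :: u ++ nseq m true in let z := v ++ nseq m true in
  \sum_(y <- words (size x)) hr l x y * h z y =
  \sum_(j < l.+1) \sum_(y <- words (size x)) h y x * hr j y z.
Proof.
move=> lm sz x z.
have [p e] : exists p, alpha * genA false false x z = genB false false x z - q ^+ m * p.
  have [[p e1] _ _ _] := @err_divisible m (false :: u) v sz.
  exists p; rewrite -[q ^+ m * p]e1 /err1 -/x -/z.
  rewrite [genA true true x z]genA_lead; ring.
elim: l lm => [|l IH] lm.
  rewrite big_ord1 -coef_genA -coef_genB.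
  have := congr1 (fun p : {poly int} => p`_0) e.
  rewrite mulrBl mul1r !coefB coefXM coefXnM lm /= !subr0 => ->; by [].
rewrite big_ord_recr -IH ?(ltnW lm) // -!coef_genA -coef_genB.
have := congr1 (fun p : {poly int} => p`_l.+1) e.
rewrite mulrBl mul1r !coefB coefXM coefXnM lm /= subr0 => <-.
by rewrite addrC subrK.
Qed.

(** A partition of size d has at most d nonzero parts, and each zero part is a letter 1 at the end
    of the word. *)
Lemma trailing_ones w : {v | w = v ++ nseq (ones w - deg w) true}.
Proof.
case: (word_split w) => [[m ->]|[[v m] ->]] /=.
  by exists [::]; rewrite deg_nseq subn0 ones_nseq mul1n.
have le : (ones (v ++ false :: nseq m true) - deg (v ++ false :: nseq m true) <= m)%N.
  by rewrite deg_shift ones_cat ones_cons ones_nseq; lia.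
exists (v ++ false :: nseq (m - (ones (v ++ false :: nseq m true) - deg (v ++ false :: nseq m true))) true).
by rewrite -catA /= -[in LHS](subnK le) nseqD.
Qed.

Lemma heisenberg n k l x z : size x = n -> size z = n -> ones x = k -> ones z = k ->
  (deg x < n - k)%N -> (deg x + 2 * l < k)%N ->
  \sum_(y <- words n) hr l x y * h z y =
  \sum_(j < l.+1) \sum_(y <- words n) h y x * hr j y z.
Proof.
move=> xn zn xk zk lt_nk lt_k.
(* If [z] has too large a degree to be reached from [x] by a strip of size l, both sides vanish
   termwise. *)
have [lt_z|le_z] := ltnP (deg x + l) (deg z).
  rewrite big1 => [|y _]; last first.
    case: (boolP (hopr l x y)) => [/andP[_ /eqP dy]|_]; last by rewrite mul0r.
    case: (boolP (hop _ z y)) => [/hop_deg|_]; last by rewrite mulr0.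
    lia.
  rewrite big1 // => j _; rewrite big1 // => y _.
  case: (boolP (hopr j y z)) => [/andP[hz /eqP dy]|_]; last by rewrite mulr0.
  case: (boolP (hop _ y x)) => [/hop_deg|_]; last by rewrite mul0r.
  by have := hop_deg hz; have := ltn_ord j; lia.
have [x' x_eq] : {x' | x = false :: x'}.
  by apply: lead0; rewrite -(addnK (ones x) (zeros x)) zerosDones xn xk.
(* Both words now have degree at most deg x + l, hence end in at least m letters 1; and l < m
   because deg x + 2 l < k. *)
pose m := (k - deg x - l)%N.
have tr w : ones w = k -> (deg w <= deg x + l)%N -> {v | w = v ++ nseq m true}.
  move=> wk le; have [v e] := trailing_ones w.
  have lem : (m <= ones w - deg w)%N by rewrite wk /m; lia.
  by exists (v ++ nseq (ones w - deg w - m) true); rewrite -catA -nseqD subnK.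
have [u xu] : {u | x' = u ++ nseq m true}.
  by apply: tr; [rewrite -xk x_eq ones_cons | rewrite x_eq leq_addr].
have [v zv] := tr z zk le_z.
have lm : (l < m)%N by rewrite /m; lia.
have sz : (size u).+1 = size v.
  by move: xn; rewrite -zn x_eq xu zv /= !size_cat; lia.
have := heisenberg_pad lm sz; lazy zeta; by rewrite -xu -x_eq -zv xn.
Qed.

Transparent genA genB.

End Heisenberg.

(** * The Leibniz rule for removing vertical strips from a product *)

Section Leibniz.
Local Notation h x y := ((hop false x y)%:R : int).
Local Notation hr r x y := ((hopr r x y)%:R : int).
Local Notation T g m d := ((tri_num g m d)%:R : int).

Lemma sum_ind (R : pzSemiRingType) (I : Type) (r : seq I) (P : pred I) (F : I -> R) :
  \sum_(i <- r | P i) F i = \sum_(i <- r) (P i)%:R * F i.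
Proof.
by rewrite big_mkcond; apply: eq_bigr => i _; case: (P i); rewrite ?mul1r ?mul0r.
Qed.

(** Read off from s_mu = 1 * s_mu, the Schur polynomial of the sorted word being 1. *)
Lemma tri_unit n k mu nu : size mu = n -> ones mu = k -> size nu = n -> ones nu = k ->
  (deg mu < n - k)%N -> T (vac (n - k) k) mu nu = (mu == nu)%:R.
Proof.
move=> mn mk nn nk lt.
have kn : (k <= n)%N by rewrite -mn -mk -zerosDones leq_addl.
have E : sch k (vac (n - k) k) * sch k mu =
    \sum_(d <- words n | ones d == k) ((mu == d)%:R : int)%:~R * sch k d.
  rewrite sch_vac mul1r (@big_words_pick _ _ _ _ mu) ?mk ?eqxx ?mul1r // => d _ _ /negPf ne.
  by rewrite eq_sym ne mul0r.
rewrite (@sch_triangle k n) ?size_vac ?subnK ?ones_vac ?deg_vac // in E.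
have := sch_free E nn nk; rewrite -natz; exact.
Qed.

(** Both sides are the coefficient of s_nu in e_l s_beta s_mu, with e_l applied to s_beta or to the
    product. The bound makes [pieri] and [sch_triangle] available for all words that occur. *)
Lemma tri_mul n k l beta mu nu :
  size beta = n -> ones beta = k -> size mu = n -> ones mu = k ->
  size nu = n -> ones nu = k -> (deg beta + deg mu + l < n - k)%N ->
  \sum_(b <- words n) hr l beta b * T b mu nu =
  \sum_(kap <- words n) T beta mu kap * hr l kap nu.
Proof.
move=> bn bk mn mk nn nk lt.
have zn w : size w = n -> ones w = k -> zeros w = (n - k)%N.
  by move=> <- <-; rewrite -zerosDones addnK.
have pierir w : size w = n -> ones w = k -> (deg w < n - k)%N ->
    tofrac (elem k l) * sch k w = \sum_(y <- words n | ones y == k) (hr l w y)%:~R * sch k y.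
  move=> wn wk ltw; have [w' ew] : {w' | w = false :: w'} by apply: lead0; rewrite zn.
  have w'k : ones w' = k by rewrite -wk ew ones_cons.
  have := pieri l w'k; rewrite -ew => ->.
  have -> : (size w').+1 = n by rewrite -wn ew.
  rewrite [LHS]sum_ind [RHS]sum_ind; apply: eq_bigr => y _; rewrite mulrA; congr (_ * _).
  rewrite mulrz_nat -natrM mulnb; case: (boolP (hop _ w y)) => [/hop_ones|]; rewrite ?andbF //.
  by rewrite wk add0n => <-; rewrite eqxx.
have := @sch_free k n (fun nu => \sum_(b <- words n) hr l beta b * T b mu nu)
  (fun nu => \sum_(kap <- words n) T beta mu kap * hr l kap nu).
apply=> //.
transitivity (tofrac (elem k l) * (sch k beta * sch k mu)).
  rewrite mulrA pierir ?mulr_suml //; last by apply: leq_ltn_trans lt; rewrite -addnA leq_addr.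
  under eq_bigr do rewrite rmorph_sum mulr_suml.
  rewrite exchange_big [RHS]sum_ind /=.
  apply: eq_big_words => b bsz.
  have [hb|hb] := boolP (hopr l beta b); last first.
    by rewrite big1 => [|i _]; rewrite ?rmorph0 !(mul0r, mulr0).
  have [hb1 /eqP hb2] := andP hb.
  have bk' : ones b = k by rewrite -bk (hop_ones hb1).
  rewrite bk' eqxx !mul1r (@sch_triangle k n) //; last first.
    by move: lt; rewrite -(subnKC (hop_deg hb1)) hb2; lia.
  by apply: eq_bigr => d _; rewrite mul1r natz.
rewrite (@sch_triangle k n) //; last by apply: leq_ltn_trans lt; rewrite leq_addr.
rewrite mulr_sumr sum_ind.
under [RHS]eq_bigr do rewrite rmorph_sum mulr_suml.
rewrite [RHS]exchange_big /=; apply: eq_big_words => d dn.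
have [dk|dk] := eqVneq (ones d) k; last first.
  rewrite mul0r big1 // => i /eqP ik.
  case: (boolP (hop _ d i)) => [/hop_ones|]; last by rewrite mulr0 rmorph0 mul0r.
  by rewrite add0n ik => /eqP; rewrite (negPf dk).
rewrite mul1r mulrCA.
have [T0|T0] := eqVneq (tri_num beta mu d) 0%N.
  by rewrite T0 mul0r big1 // => i _; rewrite mul0r rmorph0 mul0r.
rewrite pierir //; last first.
  rewrite (Tr_graded_T _ _ _ T0) ?bn ?dn ?mn ?bk //.
  by apply: leq_ltn_trans lt; rewrite leq_addr.
rewrite mulr_sumr; apply: eq_bigr => y _.
by rewrite intrM (natz (tri_num beta mu d)) mulrA.
Qed.

Lemma deg0_vac w : deg w = 0%N -> w = vac (zeros w) (ones w).
Proof.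
case: (word_split w) => [[m ->]|[[v m] ->]] /=.
  by rewrite zeros_nseq ones_nseq mul1n.
move=> d0; have v0 : ones v = 0%N by move: d0; rewrite deg_shift; lia.
set s := size v; rewrite (ones0_nseq v0) -/s.
have -> : nseq s false ++ false :: nseq m true = vac s.+1 m.
  by rewrite -cat_rcons; congr (_ ++ _); elim: s => //= s ->.
by rewrite zeros_vac ones_vac.
Qed.

(* The rule e^perp(f g) = e^perp(f) e^perp(g) for the generating function e^perp
   of the operators adjoint to multiplication by elementary symmetric functions.
   The bounds keep all words involved away from the sides of the box. *)
Lemma leibniz n k beta mu nu :
  size beta = n -> ones beta = k -> size mu = n -> ones mu = k ->
  size nu = n -> ones nu = k ->
  (deg beta + deg mu < n - k)%N -> (3 * (deg beta + deg mu) < k)%N ->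
  \sum_(y <- words n) h nu y * T beta mu y =
  \sum_(b <- words n) \sum_(m <- words n) h b beta * h m mu * T b m nu.
Proof.
pose ok (i : seq bool * seq bool) b := let: (mu, nu) := i in
  [/\ size b = n, ones b = k, size mu = n /\ ones mu = k, size nu = n /\ ones nu = k &
   (deg b + deg mu < n - k)%N /\ (3 * (deg b + deg mu) < k)%N].
pose f (i : seq bool * seq bool) beta := let: (mu, nu) := i in
  \sum_(y <- words n) h nu y * T beta mu y -
  \sum_(b <- words n) \sum_(m <- words n) h b beta * h m mu * T b m nu.
suff f0 i b : ok i b -> f i b = 0.
  move=> bn bk mn mk nn nk lt1 lt2; apply/eqP; rewrite -subr_eq0; apply/eqP.
  by apply: (f0 (mu, nu)).
apply: word_ind => {i b beta mu nu}.
- move=> [mu nu] p q [pqn]; rewrite ones_vac => qk [mn mk] [nn nk].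
  rewrite deg_vac !add0n => -[lt _]; rewrite /f.
  have p_nk : p = (n - k)%N by rewrite -pqn size_vac qk addnK.
  rewrite p_nk qk [X in _ - X](bigD1_seq (vac (n - k) k)) ?uniq_words //=; last first.
    by rewrite mem_words -p_nk -qk pqn.
  rewrite [X in _ - (_ + X)]big1 ?addr0 => [|b ne]; last first.
    case: (boolP (hop false b _)) => [hb|_]; last first.
      by rewrite big1 // => m _; rewrite !mul0r.
    case/eqP: ne; have db := hop_deg hb; rewrite deg_vac leqn0 in db.
    rewrite (deg0_vac (eqP db)); have := hop_ones hb; have := hop_zeros hb.
    by rewrite !add0n zeros_vac ones_vac => -> ->.
  apply/eqP; rewrite subr_eq0; apply/eqP.
  have hv : hop false (vac (n - k) k) (vac (n - k) k).
    by elim: (n - k)%N => [|i IH] //=; elim: (k).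
  have nu_sum : \sum_(m <- words n) h m mu * (m == nu)%:R = h nu mu.
    rewrite (bigD1_seq nu) ?uniq_words ?mem_words ?nn //= eqxx mulr1 big1 ?addr0 //.
    by move=> m /negPf ->; rewrite mulr0.
  have mu_sum : \sum_(y <- words n) h nu y * (mu == y)%:R = h nu mu.
    rewrite (bigD1_seq mu) ?uniq_words ?mem_words ?mn //= eqxx mulr1 big1 ?addr0 //.
    by move=> m /negPf; rewrite eq_sym => ->; rewrite mulr0.
  transitivity (h nu mu); [rewrite -mu_sum | rewrite -nu_sum].
    apply: eq_big_words => y yn.
    case: (boolP (hop _ nu y)) => [/hop_ones|_]; last by rewrite !mul0r.
    by rewrite add0n nk => yk; rewrite tri_unit.
  apply: eq_big_words => m msz; rewrite hv mul1r.
  case: (boolP (hop _ m mu)) => [hm|_]; last by rewrite !mul0r.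
  have := hop_ones hm; have := hop_deg hm; rewrite add0n mk => dm mk'.
  by rewrite tri_unit //; apply: leq_ltn_trans lt.
- move=> [mu nu] x y sxy oxy dxy [xn xk ? ? ?].
  by split; rewrite -?sxy -?oxy -?dxy.
move=> [mu nu] v m0 x [wn wk [mn mk] [nn nk] [lt1 lt2]] IH.
have xn : size x = n by rewrite -wn /x /= !size_cat addnS.
have xk : ones x = k by rewrite -wk /x ones_cons !ones_cat ones_cons.
have := deg_shift v m0; rewrite -/x; set l := ones v => dw; rewrite dw in lt1 lt2.
rewrite xn sum_ind.
under eq_bigr do rewrite mulrBr.
rewrite sumrB; apply/eqP; rewrite subr_eq0; apply/eqP.
have IHx y : size y = n -> ones y = k ->
    \sum_(kap <- words n) h y kap * T x mu kap =
    \sum_(b <- words n) \sum_(m <- words n) h b x * h m mu * T b m y.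
  move=> yn yk; apply/eqP; rewrite -subr_eq0; apply/eqP; apply: (IH (mu, y)).
  by split=> //; split; [apply: leq_ltn_trans lt1 | apply: leq_ltn_trans lt2]; lia.
pose B j b b3 := \sum_(y <- words n) h y b * hr j y b3.
(* Here deg w + 2 l is at most deg x + deg mu + 2 l, which the factor 3 in the hypothesis keeps
   below k. *)
have heis w : size w = n -> ones w = k -> (deg w <= deg x + deg mu)%N ->
   forall z, size z = n -> ones z = k ->
   \sum_(y <- words n) hr l w y * h z y = \sum_(j < l.+1) B j w z.
  move=> wn' wk' dw' z zn zk; apply: (@heisenberg n k) => //; lia.
(* In operator form: [tri_mul] pulls e_l out of the product, [heis] commutes it with e^perp, and the
   induction hypothesis applies to s_x s_mu. Then [tri_mul] puts each e_j back on the first factor,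
   and [heis] read backwards turns the sum of the e_j e^perp(s_x) into e^perp(e_l s_x). *)
transitivity (\sum_(j < l.+1) \sum_(b <- words n) \sum_(m <- words n)
   h b x * h m mu * \sum_(b3 <- words n) hr j b b3 * T b3 m nu).
  transitivity (\sum_(kap <- words n) T x mu kap * \sum_(j < l.+1) B j kap nu).
    transitivity (\sum_(y <- words n) h nu y * \sum_(kap <- words n) T x mu kap * hr l kap y).
      under eq_bigr do rewrite mulr_sumr.
      rewrite exchange_big; apply: eq_big_words => y yn.
      case: (boolP (hop _ nu y)) => [hy|_]; last first.
        by rewrite mul0r big1 // => b _; rewrite mul0r mulr0.
      have yk : ones y = k by rewrite -nk (hop_ones hy).
      rewrite mul1r -(@tri_mul n k) //; last by rewrite addnAC.
      by apply: eq_bigr => b _; rewrite mul1r.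
    under eq_bigr do rewrite mulr_sumr.
    rewrite exchange_big; apply: eq_big_words => kap kn.
    have [T0|T0] := eqVneq (tri_num x mu kap) 0%N.
      by rewrite T0 mul0r big1 // => y _; rewrite mul0r mulr0.
    have [kk|kk] := eqVneq (ones kap) k; last first.
      rewrite big1 => [|y _]; last first.
        case: (boolP (hop _ nu y)) => [hy|_]; last by rewrite mul0r.
        case: (boolP (hop _ kap y)) => [hk|_]; last by rewrite !mulr0.
        by have := hop_ones hy; rewrite -(hop_ones hk) nk => e; rewrite e eqxx in kk.
      rewrite big1 ?mulr0 // => j _; rewrite /B big1 // => y _.
      case: (boolP (hop _ y nu)) => [hy|_]; last by rewrite mulr0.
      case: (boolP (hop _ y kap)) => [hk|_]; last by rewrite mul0r.
      by have := hop_ones hy; rewrite (hop_ones hk) !add0n nk => e; rewrite e eqxx in kk.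
    rewrite -heis //; last first.
      by rewrite (Tr_graded_T _ _ _ T0) ?xn ?kn ?mn ?xk.
    rewrite mulr_sumr; apply: eq_bigr => y _; ring.
  under eq_bigr do rewrite mulr_sumr.
  rewrite exchange_big; apply: eq_bigr => j _ /=.
  transitivity (\sum_(y <- words n) hr j y nu * \sum_(kap <- words n) h y kap * T x mu kap).
    under eq_bigr do rewrite mulr_sumr.
    rewrite exchange_big; apply: eq_bigr => y _ /=; rewrite mulr_sumr.
    by apply: eq_bigr => kap _; ring.
  transitivity (\sum_(y <- words n) \sum_(b <- words n) \sum_(m <- words n)
      h b x * h m mu * (T b m y * hr j y nu)).
    apply: eq_big_words => y yn.
    case: (boolP (hop _ y nu)) => [hy|_]; last first.
      by rewrite mul0r big1 // => b _; rewrite big1 // => m _; rewrite !mulr0.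
    rewrite IHx ?mulr_sumr //; last by rewrite -nk (hop_ones hy).
    apply: eq_bigr => b _; rewrite mulr_sumr; apply: eq_bigr => m _; ring.
  rewrite exchange_big; apply: eq_big_words => b bn.
  rewrite exchange_big; apply: eq_big_words => m msz /=; rewrite -mulr_sumr.
  case: (boolP (hop _ b x)) => [hb|_]; last by rewrite !mul0r.
  case: (boolP (hop _ m mu)) => [hm|_]; last by rewrite !(mulr0, mul0r).
  congr (_ * _); rewrite (@tri_mul n k) //.
  - by rewrite -xk (hop_ones hb).
  - by rewrite -mk (hop_ones hm).
  - have := hop_deg hb; have := hop_deg hm; have := ltn_ord j.
    by move: lt1; lia.
transitivity (\sum_(b3 <- words n) (\sum_(j < l.+1) B j x b3) *
   \sum_(m <- words n) h m mu * T b3 m nu).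
  under [RHS]eq_bigr do rewrite mulr_suml.
  rewrite [RHS]exchange_big; apply: eq_bigr => j _ /=.
  under [RHS]eq_bigr do rewrite mulr_suml.
  rewrite [RHS]exchange_big; apply: eq_bigr => b _ /=.
  under eq_bigr do rewrite mulr_sumr.
  rewrite exchange_big; apply: eq_bigr => b3 _ /=; rewrite mulr_sumr.
  by apply: eq_bigr => m _; ring.
transitivity (\sum_(b3 <- words n) (\sum_(y <- words n) hr l x y * h b3 y) *
   \sum_(m <- words n) h m mu * T b3 m nu).
  apply: eq_big_words => b3 b3n.
  have [b3k|b3k] := eqVneq (ones b3) k.
    by rewrite -heis // leq_addr.
  rewrite [\sum_(j < _) _]big1 => [|j _]; last first.
    rewrite /B big1 // => y _.
    case: (boolP (hop _ y b3)) => [hy|_]; last by rewrite mulr0.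
    case: (boolP (hop _ y x)) => [hk|_]; last by rewrite mul0r.
    by have := hop_ones hy; rewrite (hop_ones hk) !add0n xk => e; rewrite e eqxx in b3k.
  rewrite [\sum_(y <- _) hr l x y * _]big1 // => y _.
  case: (boolP (hop _ b3 y)) => [hy|_]; last by rewrite mulr0.
  case: (boolP (hop _ x y)) => [hk|_]; last by rewrite mul0r.
  by have := hop_ones hk; rewrite -(hop_ones hy) xk => e; rewrite e eqxx in b3k.
under eq_bigr do rewrite mulr_suml.
rewrite exchange_big; apply: eq_bigr => y _ /=; rewrite mulr_sumr.
apply: eq_bigr => b3 _; rewrite !mulr_sumr; apply: eq_bigr => m _; ring.
Qed.

End Leibniz.

(** The relation at X = 1, with the sizes of the strips forgotten. *)
Lemma Tr_hop beta gamma nu delta :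
  size gamma = size delta -> size nu = (size beta + size gamma)%N ->
  \sum_(y <- words (size nu)) (hop false nu y)%:R * (Tr beta gamma y delta)%:R =
  \sum_(b <- words (size beta)) \sum_(g <- words (size gamma))
    (hop false b beta)%:R * (hop false gamma g)%:R * (Tr b g nu delta)%:R :> int.
Proof.
move=> sgd snu; have := congr1 (horner_eval 1) (Tr_hopw sgd snu).
have ev x y : horner_eval 1 (hopw 'X false x y) = (hop false x y)%:R :> int.
  rewrite hopwE rmorphM rmorphXn rmorph_nat /=.
  by rewrite [horner_eval 1 'X]hornerX expr1n mulr1.
rewrite !rmorph_sum /=; under eq_bigr do rewrite rmorphM rmorph_nat /= ev.
move=> ->; apply: eq_bigr => b _; rewrite rmorph_sum; apply: eq_bigr => g _.
by rewrite !rmorphM rmorph_nat /= !ev.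
Qed.

Lemma big_words_rcons (M : nmodType) n (F : seq bool -> M) :
  \sum_(w <- words n.+1) F w =
  \sum_(w <- words n) F (rcons w false) + \sum_(w <- words n) F (rcons w true).
Proof.
elim: n F => [|n IH] F; first by rewrite big_wordsS !big_words0.
rewrite [LHS]big_wordsS [X in X + _]IH [X in _ + X]IH.
by rewrite [X in _ = X + _]big_wordsS [X in _ = _ + X]big_wordsS addrACA.
Qed.

Lemma hop_rcons a c x y : size x = size y ->
  hop a (rcons x c) (rcons y true) = c && hop a x y.
Proof.
elim: x y a => [|b x IH] [|d y] a // => [_|[sz]].
  by rewrite /hop; case: c; case: a.
rewrite !rcons_cons -[hop a (b :: _) _]/(if b then (if a then hop d (rcons x c) (rcons y true)
  else d && hop false (rcons x c) (rcons y true)) else ~~ a && hop d (rcons x c) (rcons y true)).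
rewrite !IH // -[hop a (b :: _) _]/(if b then (if a then hop d x y
  else d && hop false x y) else ~~ a && hop d x y).
by case: b; case: a; rewrite ?andbF // andbCA.
Qed.

(** Leading 0s and trailing 1s cannot take part in a removal, so the words below a padded word are
    the padded words below [beta]. *)
Lemma sum_hop_pad (R : pzSemiRingType) p q beta (G : seq bool -> R) :
  \sum_(b <- words (p + size beta + q))
    (hop false b (nseq p false ++ beta ++ nseq q true))%:R * G b =
  \sum_(b <- words (size beta))
    (hop false b beta)%:R * G (nseq p false ++ b ++ nseq q true).
Proof.
elim: p G => [|p IHp] G.
  rewrite add0n /=; elim: q G => [|q IHq] G.
    by rewrite addn0 cats0; apply: eq_bigr => b _; rewrite cats0.
  have nS w : w ++ nseq q.+1 true = rcons (w ++ nseq q true) true.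
    by rewrite rcons_cat; congr (_ ++ _); elim: (q) => //= i <-.
  rewrite addnS big_words_rcons nS.
  have sz w : size w = (size beta + q)%N -> size w = size (beta ++ nseq q true).
    by rewrite size_cat size_nseq.
  rewrite (eq_big_words (G := fun=> 0)) => [|w /sz wn]; last first.
    by rewrite hop_rcons // mul0r.
  rewrite big1 // add0r.
  rewrite (eq_big_words (G := fun w => (hop false w (beta ++ nseq q true))%:R * G (rcons w true)))
    => [|w /sz wn]; last by rewrite hop_rcons.
  by rewrite (IHq (fun w => G (rcons w true))); apply: eq_bigr => b _; rewrite nS.
rewrite !addSn big_wordsS /= [X in _ + X]big1 ?addr0 => [|w _]; last first.
  by rewrite mul0r.
exact: (IHp (fun w => G (false :: w))).
Qed.

Lemma deg_pad p q w : deg (nseq p false ++ w ++ nseq q true) = deg w.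
Proof. by rewrite !deg_cat !deg_nseq zeros_nseq ones_nseq; lia. Qed.

Lemma pad_vacP p q w : (nseq p false ++ w ++ nseq q true == vac (p + zeros w) (ones w + q))
  = (deg w == 0%N).
Proof.
apply/eqP/eqP => [/(congr1 deg)|/deg0_vac {1}->].
  by rewrite deg_pad deg_vac.
by rewrite /vac !nseqD -!catA.
Qed.

(** * The right-hand side of the theorem satisfies the relation of [Tr] *)

Section Formula.
Local Notation T g m d := ((tri_num g m d)%:R : int).

(** The right-hand side of the theorem with both coefficients replaced by triangular puzzle counts
    and the padding written out. *)
Definition formula (beta gamma nu delta : seq bool) : int :=
  \sum_(m <- words (size gamma) | ones m == ones gamma)
    T (nseq (zeros gamma) false ++ beta ++ nseq (ones gamma) true)
      (nseq (zeros beta) false ++ m ++ nseq (ones beta) true) nu * T gamma m delta.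

Lemma size_pad2 p q (w : seq bool) :
  size (nseq p false ++ w ++ nseq q true) = (p + size w + q)%N.
Proof. by rewrite !size_cat !size_nseq addnA. Qed.

Lemma ones_pad2 p q w : ones (nseq p false ++ w ++ nseq q true) = (ones w + q)%N.
Proof. by rewrite !ones_cat !ones_nseq; lia. Qed.

Lemma formula_graded beta gamma nu delta :
  size gamma = size delta -> size nu = (size beta + size gamma)%N ->
  formula beta gamma nu delta != 0 ->
  (deg beta + deg delta = deg gamma + deg nu)%N.
Proof.
move=> sgd sn; apply: contra_neq_eq => ne.
rewrite /formula big_seq_cond big1 // => m /andP[].
rewrite mem_words => /eqP mn /eqP mk.
set B := nseq _ _ ++ beta ++ _; set M := nseq _ _ ++ m ++ _.
have [->|t1] := eqVneq (tri_num B M nu) 0%N; first by rewrite mul0r.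
have [->|t2] := eqVneq (tri_num gamma m delta) 0%N; first by rewrite mulr0.
have zb := zerosDones beta; have zg := zerosDones gamma.
have e2 : deg delta = (deg gamma + deg m)%N by apply: Tr_graded_T t2.
have e1 : deg nu = (deg B + deg M)%N.
  by apply: Tr_graded_T t1; rewrite ?size_pad2 ?ones_pad2 ?sn ?mn ?mk; lia.
by case/eqP: ne; rewrite e1 e2 !deg_pad; lia.
Qed.

(** [leibniz] removes strips from both arguments of the first factor, inside [beta] and [m] by
    [sum_hop_pad]. [Tr_hop] with empty base, applied to the second factor, trades the strip removed
    from [m] for one added to [gamma]. In nonzero terms deg m = deg delta - deg gamma, which gives
    the bounds their form. *)
Lemma formula_hop beta gamma nu delta :
  size gamma = size delta ->
  size nu = (size beta + size gamma)%N -> ones nu = (ones beta + ones gamma)%N ->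
  (deg beta + deg delta < deg gamma + (zeros beta + zeros gamma))%N ->
  (3 * (deg beta + deg delta) < 3 * deg gamma + (ones beta + ones gamma))%N ->
  \sum_(y <- words (size nu)) (hop false nu y)%:R * formula beta gamma y delta =
  \sum_(b <- words (size beta)) \sum_(g <- words (size gamma))
    (hop false b beta)%:R * (hop false gamma g)%:R * formula b g nu delta.
Proof.
move=> sgd sn on lt1 lt2.
set h := fun x y => (hop false x y)%:R : int.
pose B b := nseq (zeros gamma) false ++ b ++ nseq (ones gamma) true.
pose M m := nseq (zeros beta) false ++ m ++ nseq (ones beta) true.
have zb := zerosDones beta; have zg := zerosDones gamma.
transitivity (\sum_(m <- words (size gamma) | ones m == ones gamma)
   (\sum_(y <- words (size nu)) h nu y * T (B beta) (M m) y) * T gamma m delta).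
  under eq_bigr do rewrite /formula mulr_sumr.
  rewrite exchange_big; apply: eq_bigr => m _ /=; rewrite mulr_suml.
  by apply: eq_bigr => y _; rewrite mulrA.
transitivity (\sum_(m <- words (size gamma) | ones m == ones gamma)
   (\sum_(b <- words (size beta)) \sum_(m' <- words (size gamma))
     h b beta * h m' m * T (B b) (M m') nu) * T gamma m delta).
  rewrite big_seq_cond [RHS]big_seq_cond; apply: eq_bigr => m /andP[].
  rewrite mem_words => /eqP mn /eqP mk.
  have [->|t2] := eqVneq (tri_num gamma m delta) 0%N; first by rewrite !mulr0.
  have e2 : deg delta = (deg gamma + deg m)%N by apply: Tr_graded_T t2.
  congr (_ * _).
  rewrite (@leibniz (size nu) (ones nu)) /B /M ?size_pad2 ?ones_pad2 ?deg_pad ?mn ?mk //; try lia.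
  have szB : size nu = (zeros gamma + size beta + ones gamma)%N by lia.
  have szM : size nu = (zeros beta + size m + ones beta)%N by rewrite mn; lia.
  rewrite {1}szB.
  under eq_bigr do under eq_bigr do rewrite -mulrA.
  under eq_bigr do rewrite -mulr_sumr.
  rewrite (sum_hop_pad _ _ _ (fun b => \sum_(m' <- words (size nu))
     (hop false m' (nseq (zeros beta) false ++ m ++ nseq (ones beta) true))%:R * T b m' nu)).
  apply: eq_bigr => b _; rewrite szM (sum_hop_pad _ _ _ (fun m' => T _ m' nu)) mn.
  by rewrite mulr_sumr; apply: eq_bigr => m' _; rewrite mulrA.
transitivity (\sum_(b <- words (size beta)) \sum_(m' <- words (size gamma) | ones m' == ones gamma)
   h b beta * T (B b) (M m') nu * \sum_(m <- words (size gamma)) h m' m * T gamma m delta).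
  rewrite sum_ind; under eq_bigr do rewrite mulr_suml mulr_sumr.
  rewrite exchange_big; apply: eq_bigr => b _ /=.
  under eq_bigr do rewrite mulr_suml mulr_sumr.
  rewrite exchange_big [RHS]sum_ind; apply: eq_bigr => m' _ /=.
  rewrite !mulr_sumr; apply: eq_bigr => m _.
  rewrite /h; case: (boolP (hop _ m' m)) => [/hop_ones ->|_]; last by rewrite !(mulr0, mul0r).
  rewrite add0n; ring.
apply: eq_big_words => b bn; rewrite sum_ind.
have [hb|hb] := boolP (hop false b beta); last first.
  rewrite /h (negPf hb) big1 => [|i _]; last by rewrite !(mul0r, mulr0).
  by rewrite big1 // => i _; rewrite !mul0r.
transitivity (\sum_(g <- words (size gamma)) h b beta * h gamma g *
   \sum_(m' <- words (size gamma))
     ((ones m' == ones gamma)%:R * (T (B b) (M m') nu * T g m' delta))).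
  under [RHS]eq_bigr do rewrite mulr_sumr.
  rewrite [RHS]exchange_big; apply: eq_big_words => m' m'n /=.
  have := @Tr_hop [::] gamma m' delta sgd m'n; rewrite m'n big_words0 /= => ->.
  rewrite !mulr_sumr; apply: eq_bigr => g _; rewrite /h mul1r; ring.
apply: eq_big_words => g gn; rewrite /h hb.
have [hg|_] := boolP (hop false gamma g); last by rewrite mulr0 !mul0r.
congr (_ * _); rewrite /formula gn [RHS]sum_ind.
have := hop_ones hg; have := hop_zeros hg; have := hop_ones hb; have := hop_zeros hb.
rewrite !add0n => zb' ob' zg' og'.
by rewrite /B /M -zg' og' zb' -ob'.
Qed.

Lemma Tr_formula_large beta gamma nu delta :
  size gamma = size delta -> ones gamma = ones delta ->
  size nu = (size beta + size gamma)%N -> ones nu = (ones beta + ones gamma)%N ->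
  (deg nu < zeros beta + zeros gamma)%N -> (3 * deg nu < ones beta + ones gamma)%N ->
  (Tr beta gamma nu delta)%:R = formula beta gamma nu delta.
Proof.
pose ok (i : seq bool * seq bool * seq bool) nu := let: (beta, gamma, delta) := i in
  [/\ size gamma = size delta, ones gamma = ones delta,
     size nu = (size beta + size gamma)%N, ones nu = (ones beta + ones gamma)%N &
  (deg nu < zeros beta + zeros gamma)%N /\ (3 * deg nu < ones beta + ones gamma)%N].
pose f (i : seq bool * seq bool * seq bool) nu : int := let: (beta, gamma, delta) := i in
  (Tr beta gamma nu delta)%:R - formula beta gamma nu delta.
suff f0 i nu' : ok i nu' -> f i nu' = 0.
  move=> sgd ogd sn on lt1 lt2; apply/eqP; rewrite -subr_eq0; apply/eqP.
  by apply: (f0 (beta, gamma, delta)).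
apply: word_ind => {beta gamma nu delta}.
- move=> [[b g] d] p q [sgd ogd]; rewrite size_vac ones_vac => sn on _; rewrite /f.
  have p_eq : p = (zeros g + zeros b)%N.
    by move: sn; rewrite on -(zerosDones b) -(zerosDones g); lia.
  rewrite p_eq on [(ones b + _)%N]addnC Tr_vac // /formula.
  apply/eqP; rewrite subr_eq0; apply/eqP.
  have db : (b == vac (zeros b) (ones b)) = (deg b == 0%N).
    by apply/eqP/eqP => [->|/deg0_vac //]; rewrite deg_vac.
  (* By [Tr_graded_T] a nonzero count requires both degrees to be 0; then both arguments are sorted
     and [Tr_vac] gives 1. *)
  have tv m : size m = size g -> ones m = ones g ->
    tri_num (nseq (zeros g) false ++ b ++ nseq (ones g) true)
      (nseq (zeros b) false ++ m ++ nseq (ones b) true)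
      (vac (zeros g + zeros b) (ones g + ones b)) = ((deg b == 0) && (deg m == 0))%N.
    move=> mn mk; set t := tri_num _ _ _.
    have [e|ne] := boolP ((deg b == 0) && (deg m == 0))%N.
      have mz : zeros m = zeros g.
        by move: mn; rewrite -(zerosDones m) -(zerosDones g) mk; lia.
      case/andP: e => /eqP b0 /eqP m0.
      have := @Tr_vac [::] (vac (zeros g + zeros b) (ones g + ones b))
        (vac (zeros g + zeros b) (ones g + ones b)) 0 0 erefl.
      rewrite zeros_vac ones_vac !addn0 !eqxx /t => <-.
      congr (Tr _ _ _ _); apply/eqP.
        by rewrite [(ones g + _)%N]addnC pad_vacP b0.
      by rewrite [(zeros g + _)%N]addnC -mz -mk pad_vacP m0.
    apply/eqP; apply: contraNT ne => t0.
    have zb := zerosDones b; have zg := zerosDones g.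
    have {t0} : deg (vac (zeros g + zeros b) (ones g + ones b)) = (deg b + deg m)%N.
      rewrite -(deg_pad (zeros g) (ones g) b) -(deg_pad (zeros b) (ones b) m).
      by apply: Tr_graded_T t0; rewrite ?size_pad2 ?ones_pad2 ?size_vac ?mn ?mk; lia.
    rewrite deg_vac.
    by move/esym/eqP; rewrite addn_eq0.
  have [b0|b0] := boolP (deg b == 0%N); last first.
    rewrite db (negPf b0) andbF big_seq_cond big1 // => m /andP[].
    by rewrite mem_words => /eqP mn /eqP mk; rewrite tv // (negPf b0) mul0r.
  rewrite (@big_words_pick _ _ _ _ (vac (zeros g) (ones g))).
  + rewrite tv ?size_vac ?ones_vac ?zerosDones // b0 deg_vac mul1r db b0 andbT.
    have := @Tr_vac [::] g d 0 0 sgd; rewrite !addn0 => ->.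
    by rewrite eqxx andbT.
  + by rewrite size_vac zerosDones.
  + by rewrite ones_vac.
  move=> m mn /eqP mk ne; rewrite tv // b0.
  have [m0|m0] := boolP (deg m == 0%N); last by rewrite mul0r.
  case/eqP: ne; rewrite (deg0_vac (eqP m0)) mk; congr vac.
  by move: mn; rewrite -(zerosDones m) -(zerosDones g) mk; lia.
- move=> [[b g] d] x y sxy oxy dxy [? ? ? ? ?].
  by split; rewrite -?sxy -?oxy -?dxy.
move=> [[b g] d] v m0 x okw IH.
have [sgd ogd sn on [lt1 lt2]] := okw.
have sx : size x = (size b + size g)%N by rewrite -sn /x /= !size_cat addnS.
have ox : ones x = (ones b + ones g)%N.
  by rewrite -on /x ones_cons !ones_cat ones_cons.
have := deg_shift v m0; rewrite -/x; set l := ones v => dw; rewrite dw in lt1 lt2.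
have oky y : hopr l x y -> ok (b, g, d) y.
  case/andP => hy /eqP dy; split=> //.
  - by rewrite -(hop_size hy).
  - by rewrite -ox (hop_ones hy).
  - by have -> : deg y = (deg x + l)%N by rewrite -dy subnKC // hop_deg.
have gT y : size y = size x -> ones y = ones x -> (Tr b g y d)%:R != 0 :> int ->
    (deg b + deg d = deg g + deg y)%N.
  move=> sy oy; rewrite Num.Theory.pnatr_eq0; apply: Tr_graded => //; first by rewrite sy.
  by rewrite oy.
have gF y : size y = size x -> ones y = ones x -> formula b g y d != 0 ->
    (deg b + deg d = deg g + deg y)%N.
  by move=> sy _; apply: formula_graded; rewrite // sy.
(* Both sides being graded, the size l of the strip can be dropped. *)
have [e|ne] := eqVneq (deg b + deg d)%N (deg g + (deg x + l))%N; last first.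
  rewrite big1 // => y /andP[hy /eqP dy]; apply/eqP; rewrite subr_eq0.
  have sy := esym (hop_size hy); have oy := esym (hop_ones hy).
  have dy' : (deg x + l)%N = deg y by rewrite -dy subnKC // hop_deg.
  have [->|/(gT _ sy oy) e] := eqVneq (Tr b g y d)%:R (0 : int); last first.
    by rewrite e dy' eqxx in ne.
  have [_ //|/(gF _ sy oy) e] := eqVneq (formula b g y d) 0.
  by rewrite e dy' eqxx in ne.
have drop (F : seq bool -> int) : (forall y, size y = size x -> ones y = ones x ->
     F y != 0 -> (deg b + deg d = deg g + deg y)%N) ->
   \sum_(y <- words (size x) | hopr l x y) F y =
   \sum_(y <- words (size x)) (hop false x y)%:R * F y.
  move=> Fg; rewrite [LHS]sum_ind; apply: eq_big_words => y yn.
  case: (boolP (hop _ x y)) => [hy|_] /=; last by rewrite !mul0r.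
  have [->|F0] := eqVneq (F y) 0; first by rewrite !mulr0.
  have := Fg y yn (esym (hop_ones hy)) F0; rewrite e => /addnI <-.
  by rewrite addKn eqxx.
rewrite sumrB !drop // Tr_hop // formula_hop //; try lia.
rewrite -sumrB big1_seq // => b' /andP[_]; rewrite mem_words => /eqP b'n.
rewrite -sumrB big1_seq // => g' /andP[_]; rewrite mem_words => /eqP g'n.
have [hb|_] := boolP (hop false b' b); last by rewrite !mul0r subrr.
have [hg|_] := boolP (hop false g g'); last by rewrite mulr0 !mul0r subrr.
rewrite -mulrBr; apply/eqP; rewrite mulf_eq0; apply/orP; right; apply/eqP.
have := hop_ones hg; have := hop_zeros hg; have := hop_ones hb; have := hop_zeros hb.
rewrite !add0n => zb' ob' zg' og'.
apply: (IH (b', g', d)); split; rewrite ?b'n ?g'n ?ob' -?og' //.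
by rewrite -zg' zb'; split; lia.
Qed.

End Formula.

(** * Removing the size bounds by padding *)

Lemma nseqS_true N : nseq N.+1 true = rcons (nseq N true) true.
Proof. by elim: N => //= N <-. Qed.

Lemma Tr_pad N beta gamma nu delta :
  Tr (nseq N false ++ beta ++ nseq N true) gamma
    (nseq N false ++ nu ++ nseq N true) delta = Tr beta gamma nu delta.
Proof.
have pad0 n b v : Tr (nseq n false ++ b) gamma (nseq n false ++ v) delta =
    Tr b gamma v delta by elim: n => //= n IH; rewrite Tr_cons0.
rewrite pad0; elim: N => [|N IH]; first by rewrite !cats0.
by rewrite nseqS_true -!rcons_cat Tr_rcons1.
Qed.

Lemma tri_pad N gamma mu delta : size gamma = size delta ->
  tri_num (nseq N false ++ gamma ++ nseq N true) (nseq N false ++ mu ++ nseq N true)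
    (nseq N false ++ delta ++ nseq N true) = tri_num gamma mu delta.
Proof.
move=> sgd; rewrite tri_pad0; elim: N => [|N IH]; first by rewrite !cats0.
by rewrite nseqS_true -!rcons_cat Tr_pad1 // !size_cat sgd.
Qed.

Lemma Tr_formula beta gamma nu delta :
  size gamma = size delta -> ones gamma = ones delta ->
  size nu = (size beta + size gamma)%N -> ones nu = (ones beta + ones gamma)%N ->
  (Tr beta gamma nu delta)%:R = formula beta gamma nu delta.
Proof.
(* The padding adds N to the numbers of 0s and of 1s but leaves deg nu unchanged, so this N
   satisfies both bounds. *)
move=> sgd ogd sn on; pose N := (3 * deg nu).+1.
have zpad w : zeros (nseq N false ++ w ++ nseq N true) = (zeros w + N)%N.
  by rewrite !zeros_cat !zeros_nseq; lia.
rewrite -(Tr_pad N) Tr_formula_large //; first last.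
- by rewrite deg_pad ones_pad2 /N; lia.
- by rewrite deg_pad zpad /N; lia.
- by rewrite !ones_pad2 on addnAC.
- by rewrite !size_pad2 sn; lia.
rewrite /formula big_seq_cond [RHS]big_seq_cond; apply: eq_bigr => m /andP[].
rewrite mem_words => /eqP mn /eqP mk; rewrite zpad ones_pad2.
have nseqDl i (b : bool) w : nseq (i + N) b ++ w = nseq N b ++ nseq i b ++ w.
  by rewrite addnC nseqD catA.
have nseqDr i (b : bool) : nseq (i + N) b = nseq i b ++ nseq N b by rewrite nseqD.
have swap i (b : bool) w : nseq i b ++ nseq N b ++ w = nseq N b ++ nseq i b ++ w.
  by rewrite !catA -!nseqD addnC.
have swap' i (b : bool) : nseq N b ++ nseq i b = nseq i b ++ nseq N b.
  by rewrite -!nseqD addnC.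
(* Padding [beta] also widens the padding of [m] by N at both ends. Regrouped, the first triangle is
   the original one padded by N, which [tri_pad] undoes. *)
rewrite nseqDl nseqDr -!catA swap swap'.
rewrite -(@tri_pad N _ _ nu) ?size_pad2; last first.
  by have := zerosDones gamma; rewrite sn; lia.
by rewrite -!catA.
Qed.

(** * Puzzles on a trapezoid, strip by strip *)

Definition upd (f : edge -> label) (e : edge) (l : label) : edge -> label :=
  fun e' => if e' == e then l else f e'.

(* The sum of Q over all labelings that agree with f outside E. *)
Fixpoint sumE (E : seq edge) (Q : (edge -> label) -> nat) (f : edge -> label) : nat :=
  if E is e :: E' then \sum_(l <- labels) sumE E' Q (upd f e l) else Q f.

Lemma updN f e l e' : e' != e -> upd f e l e' = f e'.
Proof. by rewrite /upd => /negPf ->. Qed.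

Lemma sumE_cat E E' Q f : sumE (E ++ E') Q f = sumE E (sumE E' Q) f.
Proof. by elim: E f => //= e E IH f; apply: eq_bigr => l _; apply: IH. Qed.

Lemma sumE_local E Q Q' f :
  (forall f', (forall e, e \notin E -> f' e = f e) -> Q f' = Q' f') ->
  sumE E Q f = sumE E Q' f.
Proof.
elim: E f => [|e E IH] f QQ' /=; first exact: QQ'.
apply: eq_bigr => l _; apply: IH => f' f'E; apply: QQ' => e'.
by rewrite inE negb_or => /andP[ne /f'E ->]; rewrite /upd (negPf ne).
Qed.

Lemma sumE_mull E c Q f : sumE E (fun f => (c * Q f)%N) f = (c * sumE E Q f)%N.
Proof.
by elim: E f => //= e E IH f; rewrite big_distrr; apply: eq_bigr => l _; apply: IH.
Qed.

Lemma sumE_sum (I : Type) (r : seq I) E (Q : I -> (edge -> label) -> nat) f :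
  sumE E (fun f => \sum_(i <- r) Q i f)%N f = (\sum_(i <- r) sumE E (Q i) f)%N.
Proof.
elim: E f => //= e E IH f; rewrite [RHS]exchange_big; apply: eq_bigr => l _; exact: IH.
Qed.

Lemma sumE3 e1 e2 e3 Q f :
  sumE [:: e1; e2; e3] Q f = (\sum_(l1 <- labels) \sum_(l2 <- labels)
    \sum_(l3 <- labels) Q (upd (upd (upd f e1 l1) e2 l2) e3 l3))%N.
Proof. by []. Qed.

Lemma sum_labels (l0 : label) (F : label -> nat) :
  (\sum_(l <- labels) (l == l0) * F l)%N = F l0.
Proof.
by rewrite /labels !big_cons big_nil; case: l0;
  rewrite /= ?mul0n ?mul1n ?add0n ?addn0.
Qed.

Lemma sumE_word es W H f : uniq es -> size W = size es ->
  sumE es (fun f => ([seq f e | e <- es] == W) * H [seq f e | e <- es])%N f = H W.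
Proof.
elim: es W H f => [|e es IH] [|l0 W] H f //=; first by rewrite mul1n.
move=> /andP[e_es uniq_es] [sW].
rewrite -(IH W (fun w => H (l0 :: w)) (upd f e l0)) //.
rewrite -(sum_labels l0 (fun l => sumE es (fun f => ([seq f e | e <- es] == W) *
   H (l0 :: [seq f e | e <- es]))%N (upd f e l))).
apply: eq_bigr => l _; rewrite -sumE_mull; apply: sumE_local => f' f'E.
have -> : f' e = l by rewrite f'E // /upd eqxx.
by rewrite eqseq_cons; case: eqP => [->|]; rewrite ?mul1n ?mul0n.
Qed.

Lemma sumN_stripl_nil g d (K : seq label -> nat) :
  (\sum_(x <- stripl g [::] d) K x = \sum_(o <- labels) tri g o d * K [:: o])%N.
Proof.
rewrite /= big_map big_filter big_mkcond.
by apply: eq_bigr => o _; case: tri; rewrite ?mul0n ?mul1n.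
Qed.

Lemma sumN_stripl_cons g i w d (K : seq label -> nat) :
  (\sum_(x <- stripl g (i :: w) d) K x =
  \sum_(s <- labels) \sum_(t <- labels) tri s t i * \sum_(o <- labels)
    tri g o s * \sum_(x <- stripl t w d) K (o :: x))%N.
Proof.
rewrite [LHS](@big_stripl_cons nat) big_filter big_mkcond big_allpairs.
apply: eq_bigr => s _; apply: eq_bigr => t _ /=.
case: tri; rewrite ?mul0n // mul1n big_filter big_mkcond.
by apply: eq_bigr => o _; case: tri; rewrite ?mul0n ?mul1n.
Qed.

Section Strip.
Variable m : nat.

(** Every edge of the strip off its inner line belongs to exactly one upward triangle, so these
    triangles enumerate the unknown labels. *)
Definition tri_edges (j : nat) : seq edge :=
  [:: (E60, (j, m - j)); (E120, (j, m - j)); (E0, (j, m - j))]%N.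

Definition strip_edges (j n : nat) : seq edge :=
  flatten [seq tri_edges i | i <- iota j n.+1].

Definition up_ok (f : edge -> label) (j : nat) : bool :=
  tri (f (E60, (j, m - j)%N)) (f (E120, (j, m - j)%N)) (f (E0, (j, m - j)%N)).
Definition down_ok (f : edge -> label) (j : nat) : bool :=
  tri (f (E0, (j, m - j)%N)) (f (E60, (j.+1, m - j.+1)%N))
    (f (E120, (j, m - j.+1)%N)).

Definition strip_ok (j n : nat) (g d : label) (f : edge -> label) : bool :=
  [&& f (E60, (j, m - j)%N) == g, f (E0, (j + n, m - (j + n))%N) == d,
      all (up_ok f) (iota j n.+1) & all (down_ok f) (iota j n)].

Lemma mem_strip_edges j n d x y :
  ((d, (x, y)) \in strip_edges j n) = (j <= x <= j + n)%N && (y == m - x)%N.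
Proof.
apply/flattenP/idP => [[_ /mapP[i + ->]]|/andP[lex /eqP ->]].
  rewrite mem_iota addnS ltnS => lei; rewrite !inE !xpair_eqE.
  by move=> /or3P[] /and3P[_ /eqP -> /eqP ->]; rewrite lei eqxx.
exists (tri_edges x); first by apply: map_f; rewrite mem_iota addnS ltnS.
by rewrite !inE !xpair_eqE !eqxx !andbT; case: d.
Qed.

(** The first upward triangle and the downward triangle after it make up one unfolding of [stripl];
    the left edge of the next upward triangle carries the label [t] on which the recursion
    continues. *)
Lemma sumE_strip j n g d (H : seq label -> nat) f : (j + n = m)%N ->
  sumE (strip_edges j n) (fun f' => strip_ok j n g d f' *
     H [seq f' (E120, (i, m - i)%N) | i <- iota j n.+1])%N f =
  (\sum_(x <- stripl g [seq f (E120, (i, m - i.+1)%N) | i <- iota j n] d) H x)%N.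
Proof.
elim: n j g H f => [|n IH] j g H f jnm.
  rewrite sumN_stripl_nil /strip_ok addn0.
  rewrite -(sum_labels g (fun l => \sum_(o <- labels) tri l o d * H [:: o]))%N.
  rewrite [LHS]/=; apply: eq_bigr => l1 _; rewrite big_distrr.
  apply: eq_bigr => l2 _ /=.
  rewrite -(sum_labels d (fun l => (l1 == g) * (tri l1 l2 l * H [:: l2])))%N.
  apply: eq_bigr => l3 _; rewrite /up_ok /upd /= !eqxx !andbT.
  by case: (l1 == g); case: (l3 == d); case: tri; rewrite /= ?mul0n ?mul1n.
have -> : strip_edges j n.+1 = tri_edges j ++ strip_edges j.+1 n by [].
rewrite sumE_cat sumE3 [X in stripl _ X]/= sumN_stripl_cons.
set i := f _; pose w := [seq f (E120, (i, m - i.+1)%N) | i <- iota j.+1 n].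
pose F l2 t := (\sum_(x <- stripl t w d) H (l2 :: x))%N.
transitivity (\sum_(l <- labels) (l == g) * \sum_(l2 <- labels) \sum_(l3 <- labels)
   tri l l2 l3 * \sum_(t <- labels) tri l3 t i * F l2 t)%N; last first.
  rewrite sum_labels exchange_big; apply: eq_bigr => l3 _.
  rewrite /F; under eq_bigr do rewrite big_distrr.
  rewrite exchange_big; apply: eq_bigr => t _; rewrite big_distrr.
  by apply: eq_bigr => o _; exact: mulnCA.
apply: eq_bigr => l1 _; rewrite big_distrr; apply: eq_bigr => l2 _.
rewrite big_distrr; apply: eq_bigr => l3 _; set f3 := upd _ _ _.
rewrite /F.
under [X in _ = (_ * (_ * X))%N]eq_bigr => t _.
  have -> : w = [seq f3 (E120, (i, m - i.+1)%N) | i <- iota j.+1 n].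
    apply/eq_in_map => k; rewrite mem_iota /f3 => /andP[jk _].
    by rewrite !updN // !xpair_eqE (gtn_eqF jk) ?andbF.
  rewrite -IH ?addSnnS // -sumE_mull; over.
rewrite -sumE_sum mulnA -sumE_mull; apply: sumE_local => f' f'E.
have f'j dd : f' (dd, (j, m - j)%N) = f3 (dd, (j, m - j)%N).
  by rewrite f'E // mem_strip_edges ltnn.
have f'i : f' (E120, (j, m - j.+1)%N) = i.
  rewrite f'E ?mem_strip_edges ?ltnn // /f3 !updN // !xpair_eqE /= eqxx /=.
  by rewrite ltn_eqF //; lia.
rewrite /strip_ok addSnnS.
have f'1 : f' (E60, (j, m - j)%N) = l1 by rewrite f'j /f3 /upd !eqxx.
have f'2 : f' (E120, (j, m - j)%N) = l2 by rewrite f'j /f3 /upd !eqxx.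
have f'3 : f' (E0, (j, m - j)%N) = l3 by rewrite f'j /f3 /upd !eqxx.
set t0 := f' (E60, (j.+1, _)).
set B := all (up_ok f') (iota j.+1 n.+1); set C := all (down_ok f') (iota j.+1 n).
set D := _ == d; set w' := [seq f' (E120, (i0, m - i0)%N) | i0 <- iota j.+1 n.+1].
transitivity ((l1 == g) * tri l1 l2 l3 * (tri l3 t0 i * (D && B && C * H (l2 :: w'))))%N.
  have -> : [seq f' (E120, (i0, m - i0)%N) | i0 <- iota j n.+2] = l2 :: w'.
    by rewrite /= f'2.
  have -> : all (up_ok f') (iota j n.+2) = tri l1 l2 l3 && B.
    by rewrite /= /up_ok f'1 f'2 f'3.
  have -> : all (down_ok f') (iota j n.+1) = tri l3 t0 i && C.
    by rewrite /= /down_ok f'3 f'i.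
  rewrite f'1 !mulnA !mulnb; congr (nat_of_bool _ * _)%N.
  by case: (l1 == g); case: D; case: tri; case: B; case: tri; case: C.
congr (_ * _)%N; rewrite -(sum_labels t0 (fun t => tri l3 t i * (D && B && C * H (l2 :: w'))))%N.
apply: eq_bigr => t _; rewrite (eq_sym t0); case: eqP => _ /=.
  by rewrite mul1n -andbA.
by rewrite mul0n muln0.
Qed.
End Strip.

Lemma strip_ok_local m j n g d f f' : (j + n <= m)%N ->
  (forall dd x y, (x + y <= m)%N -> f (dd, (x, y)) = f' (dd, (x, y))) ->
  strip_ok m j n g d f = strip_ok m j n g d f'.
Proof.
move=> jnm ff'; rewrite /strip_ok !ff' ?subnKC //; last lia.
have -> : all (up_ok m f) (iota j n.+1) = all (up_ok m f') (iota j n.+1).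
  apply: eq_in_all => i; rewrite mem_iota addnS ltnS => /andP[_ lei].
  by rewrite /up_ok !ff' // subnKC //; apply: leq_trans jnm.
have -> // : all (down_ok m f) (iota j n) = all (down_ok m f') (iota j n).
apply: eq_in_all => i; rewrite mem_iota => /andP[_ lti].
by rewrite /down_ok !ff' //; lia.
Qed.

Fixpoint strips_ok (m : nat) (gamma delta : seq label) (f : edge -> label) : bool :=
  match gamma, delta with
  | g :: gamma', d :: delta' =>
      strip_ok m 0 m g d f && strips_ok m.+1 gamma' delta' f
  | _, _ => true
  end.

Definition strips_edges (m k : nat) : seq edge :=
  flatten [seq strip_edges i 0 i | i <- iota m k].

Definition inner (m : nat) (f : edge -> label) : seq label :=
  [seq f (E120, (i, m - i.+1)%N) | i <- iota 0 m].

Lemma mem_strips_edges m k d x y :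
  ((d, (x, y)) \in strips_edges m k) = (m <= x + y < m + k)%N.
Proof.
apply/flattenP/idP => [[_ /mapP[i + ->]]|mxy].
  by rewrite mem_iota mem_strip_edges add0n => + /andP[/andP[_ /subnKC] + /eqP ->] => mi ->.
exists (strip_edges (x + y) 0 (x + y)); first by apply: map_f; rewrite mem_iota.
by rewrite mem_strip_edges addKn add0n leq_addr eqxx.
Qed.

Lemma sumE_strips m gamma delta (H : seq label -> nat) f :
  size gamma = size delta ->
  sumE (strips_edges m (size gamma))
    (fun f' => strips_ok m gamma delta f' * H (inner (m + size gamma) f'))%N f =
  (\sum_(x <- trapl (inner m f) gamma delta) H x)%N.
Proof.
elim: gamma delta m f => [|g gamma IH] [|d delta] m f //.
  by rewrite /= big_seq1 mul1n addn0.
case=> sz.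
have -> : strips_edges m (size (g :: gamma)) =
          strip_edges m 0 m ++ strips_edges m.+1 (size gamma) by [].
rewrite sumE_cat [trapl _ _ _]/= big_flatten big_map -(@sumE_strip m 0 m) //.
apply: sumE_local => f1 _.
rewrite -[[seq f1 _ | i <- _]]/(inner m.+1 f1) -IH // -sumE_mull.
apply: sumE_local => f2 f2E.
rewrite [strips_ok _ _ _ _]/= (@strip_ok_local m 0 m g d f2 f1) //.
  by rewrite [size _]/= addnS -addSn mulnA mulnb.
move=> dd x y xym; rewrite f2E // mem_strips_edges negb_and -ltnNge ltnS xym //.
Qed.

Definition trap_list (a c : nat) : seq edge :=
  [seq (E120, (i, a - i.+1)%N) | i <- iota 0 a] ++ strips_edges a c.

Lemma sumE_trap_list a beta gamma nu delta f :
  size beta = a -> size gamma = size delta ->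
  sumE (trap_list a (size gamma)) (fun f' => nat_of_bool
    [&& inner a f' == emb beta, strips_ok a (emb gamma) (emb delta) f'
      & inner (a + size gamma) f' == emb nu]) f =
  Tr beta gamma nu delta.
Proof.
move=> sb sz; rewrite sumE_cat.
pose es : seq edge := [seq (E120, (i, a - i.+1)%N) | i <- iota 0 a].
have innerE f' : inner a f' = [seq f' e | e <- es] by rewrite /es -map_comp.
have uniq_es : uniq es.
  by rewrite map_inj_uniq ?iota_uniq // => i j [].
rewrite -/es /Tr.
transitivity (sumE es (fun f1 => ([seq f1 e | e <- es] == emb beta) *
  \sum_(x <- trapl [seq f1 e | e <- es] (emb gamma) (emb delta)) (x == emb nu))%N f).
  apply: sumE_local => f1 _.
  rewrite -innerE -sumE_strips ?size_emb // -sumE_mull.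
  apply: sumE_local => f2 f2E.
  rewrite !innerE.
  have -> : [seq f2 e | e <- es] = [seq f1 e | e <- es].
    apply/eq_in_map => _ /mapP[i + ->]; rewrite mem_iota => /= ia.
    by rewrite f2E // mem_strips_edges; lia.
  by rewrite -!mulnb.
rewrite (@sumE_word es (emb beta) (fun w =>
  \sum_(x <- trapl w (emb gamma) (emb delta)) (x == emb nu))%N) //;
  last by rewrite size_emb size_map size_iota.
by have := sum_eq_countN (trapl (emb beta) (emb gamma) (emb delta)) (emb nu) true;
  rewrite mul1n => <-.
Qed.

Lemma uniq_flatten_iota (T : eqType) (F : nat -> seq T) (k : T -> nat) m n :
  (forall i, uniq (F i)) -> (forall i x, x \in F i -> k x = i) ->
  uniq (flatten [seq F i | i <- iota m n]).
Proof.
move=> uF kF; elim: n m => [|n IH] m //=; rewrite cat_uniq uF IH andbT.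
apply/hasPn => x /flattenP[_ /mapP[i + ->] /kF kx]; rewrite mem_iota => mi.
by apply/negP => /kF; lia.
Qed.

Lemma uniq_strips_edges m n : uniq (strips_edges m n).
Proof.
apply: (@uniq_flatten_iota _ _ (fun e : edge => e.2.1 + e.2.2)%N) => i.
  apply: (@uniq_flatten_iota _ _ (fun e : edge => e.2.1)) => [//|j e].
  by rewrite !inE => /or3P[] /eqP ->.
by case=> d [x y]; rewrite mem_strip_edges add0n => /andP[/subnKC xi /eqP ->].
Qed.

Lemma uniq_trap_list a c : uniq (trap_list a c).
Proof.
rewrite /trap_list cat_uniq uniq_strips_edges andbT.
rewrite map_inj_uniq ?iota_uniq => [|i j []//]; apply/hasPn => -[d [x y]].
rewrite mem_strips_edges => axy; apply/negP => /mapP[i + [_ xi yi]].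
by rewrite mem_iota; lia.
Qed.

Lemma mem_trap_list a c : trap_list a c =i trap_edges a c.
Proof.
move=> [d [x y]]; rewrite mem_cat mem_strips_edges mem_filter.
apply/idP/idP.
  move=> h; apply/andP; split.
    case/orP: h => [/mapP[i + [-> -> ->]]|]; first by rewrite mem_iota /= /in_trap /=; lia.
    by case: d; rewrite /= /in_trap /=; lia.
  apply/allpairsP; exists (d, (x, y)); split => //; first by case: d {h}.
  apply/allpairsP; exists (x, y); rewrite !mem_iota /=.
  by case/orP: h => [/mapP[i + [_ -> ->]]|]; rewrite ?mem_iota; split => //; lia.
case/andP=> + _; case: d; rewrite /= /in_trap /= => h.
- by rewrite orbC; apply/orP; left; lia.
- by rewrite orbC; apply/orP; left; lia.
have [e|ne] := eqVneq (x + y).+1 a; last by rewrite orbC; apply/orP; left; lia.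
apply/orP; left; apply/mapP; exists x; first by rewrite mem_iota; lia.
by congr (_, (_, _)); lia.
Qed.

(** * Labelings as finite functions, and puzzles as stacked strips *)

Section Count.
Variable s : seq edge.

(** Edges outside [s] get [L0], the constant value from which the summation in [card_ffun_sumE]
    starts. *)
Definition ext (L : {ffun seq_sub s -> label}) (e : edge) : label :=
  odflt L0 (omap L (insub e)).

Lemma sum_label (F : label -> nat) :
  (\sum_(l : label) F l = \sum_(l <- labels) F l)%N.
Proof.
by rewrite [RHS]big_uniq //; apply: eq_bigl; case.
Qed.

(** Labels outside [E] are frozen to those of [f]; each step of the induction frees one edge by
    splitting the labelings according to its label. *)
Lemma sumE_ffun E Q f : uniq E -> {subset E <= s} ->
  (forall e, e \notin s -> f e = L0) ->
  sumE E Q f =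
  (\sum_(L : {ffun seq_sub s -> label} |
     [forall e, (val e \in E) || (L e == f (val e))]) Q (ext L))%N.
Proof.
elim: E f => [|e E IH] f /=.
  move=> _ _ f0; rewrite (big_pred1 [ffun e => f (val e)]) => [|L].
    congr Q; apply: FunctionalExtensionality.functional_extensionality => e.
    rewrite /ext; case: insubP => [u us /= ue|/f0 //]; by rewrite ffunE ue.
  apply/forallP/eqP => [Lf|-> e]; last by rewrite ffunE.
  by apply/ffunP => e; rewrite ffunE; apply/eqP; apply: Lf.
case/andP=> eE uE sE f0.
have es : e \in s by apply: sE; rewrite inE eqxx.
pose u := SeqSub es.
rewrite (partition_big (fun L : {ffun seq_sub s -> label} => L u) xpredT) //=.
rewrite sum_label; apply: eq_bigr => l _; rewrite IH //; last 2 first.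
- by move=> x xE; apply: sE; rewrite inE xE orbT.
- by move=> x xs; rewrite updN ?f0 //; apply: contraNneq xs => ->.
apply: eq_bigl => L; apply/forallP/andP => [Lf|[/forallP Lf /eqP Lu] x].
  split; last by have := Lf u; rewrite /= (negPf eE) /upd eqxx.
  apply/forallP => x; have := Lf x; rewrite inE /upd.
  by case: (val x == e); rewrite ?orbT.
have := Lf x; rewrite inE /upd; case: eqP => //= xe _.
by have -> : x = u; [apply: val_inj | rewrite Lu eqxx orbT].
Qed.

Lemma card_ffun_sumE E (Q : pred (edge -> label)) : uniq E -> E =i s ->
  #|[set L : {ffun seq_sub s -> label} | Q (ext L)]| =
  sumE E (fun f => nat_of_bool (Q f)) (fun=> L0).
Proof.
move=> uE Es; rewrite sumE_ffun // => [|e]; last by rewrite Es.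
rewrite -sum1_card big_mkcond [RHS]big_mkcond; apply: eq_bigr => L _.
rewrite inE; have -> : [forall e, (val e \in E) || (L e == L0)].
  by apply/forallP => e; rewrite Es (valP e).
by case: (Q _).
Qed.
End Count.

Section Bridge.
Variables a c : nat.
Implicit Types (L : labeling a c).

Lemma reads_ext L es w : all (mem (trap_edges a c)) es ->
  reads L es w = ([seq ext L e | e <- es] == w).
Proof.
move=> /allP es_in; rewrite /reads -[RHS](inj_eq (inj_map (@Some_inj _))) -map_comp.
congr (_ == _); apply/eq_in_map => e /es_in e_in /=.
by rewrite /ext insubT.
Qed.

Lemma allowed_ext L e1 e2 e3 : all (mem (trap_edges a c)) [:: e1; e2; e3] ->
  allowed L [:: e1; e2; e3] = tri (ext L e1) (ext L e2) (ext L e3).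
Proof.
move=> e_in; rewrite /allowed /tri -[RHS]has_pred1 /=.
by rewrite !reads_ext // -!(eq_sym [:: ext L e1; ext L e2; ext L e3]).
Qed.

Lemma strips_okE m gamma delta f : size gamma = size delta ->
  strips_ok m gamma delta f =
  [&& [seq f (E60, (0, i)) | i <- iota m (size gamma)] == gamma,
      [seq f (E0, (i, 0)) | i <- iota m (size gamma)] == delta,
      all (fun i => all (up_ok i f) (iota 0 i.+1)) (iota m (size gamma))
    & all (fun i => all (down_ok i f) (iota 0 i)) (iota m (size gamma))]%N.
Proof.
elim: gamma delta m => [|g gamma IH] [|d delta] m // [sz].
rewrite [LHS]/= IH // /strip_ok subn0 add0n subnn.
have and4 b1 b2 b3 b4 b5 b6 b7 b8 :
    [&& b1, b2, b3 & b4] && [&& b5, b6, b7 & b8] =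
    [&& b1 && b5, b2 && b6, b3 && b7 & b4 && b8].
  by case: b1; case: b2; case: b3; case: b4; case: b5; case: b6; case: b7; case: b8.
exact: and4.
Qed.

(** Clockwise reading follows the direction of the strips on the NW and NE sides and opposes it on
    the SW and South sides, whence the two reversals. *)
Lemma is_puzzleE beta gamma nu delta L :
  size beta = a -> size gamma = c -> size nu = (a + c)%N -> size delta = c ->
  is_puzzle beta gamma nu delta L =
  [&& inner a (ext L) == emb (rev beta),
      strips_ok a (emb gamma) (emb (rev delta)) (ext L)
    & inner (a + c) (ext L) == emb nu].
Proof.
move=> sb sg sn sd; rewrite strips_okE ?size_emb ?size_rev ?sg //.
rewrite /is_puzzle /reads_string.
have inT (es : seq edge) : {subset es <= trap_list a c} -> all (mem (trap_edges a c)) es.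
  by move=> es_in; apply/allP => e /es_in; rewrite mem_trap_list.
have inS d x y : (a <= x + y < a + c)%N -> (d, (x, y)) \in trap_edges a c.
  by move=> xy; rewrite -mem_trap_list mem_cat mem_strips_edges xy orbT.
have in120 x y : (a <= (x + y).+1 <= a + c)%N -> (E120, (x, y)) \in trap_edges a c.
  move=> xy; rewrite mem_filter.
  apply/andP; split; first by rewrite /= /in_trap /=; lia.
  apply/allpairsP; exists (E120, (x, y)); split => //.
  by apply/allpairsP; exists (x, y); rewrite !mem_iota; split => //=; lia.
have -> : reads L (side_SW a) [seq label_of_bool b | b <- beta] =
          (inner a (ext L) == emb (rev beta)).
  rewrite reads_ext; last first.
    apply: inT => _ /mapP[i + ->]; rewrite mem_iota => /= ia.
    rewrite mem_cat; apply/orP; left; apply/mapP; exists (a - i.+1)%N.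
      by rewrite mem_iota; lia.
    by congr (_, (_, _)); lia.
  rewrite /emb map_rev -[RHS](inj_eq (can_inj revK)) revK; congr (_ == _).
  apply: (@eq_from_nth _ L0) => [|i]; first by rewrite size_rev !size_map.
  rewrite size_map size_mkseq => ia.
  rewrite nth_rev ?size_map ?size_iota //.
  rewrite (nth_map (E0, (0, 0))%N) ?size_mkseq // nth_mkseq //.
  rewrite (nth_map 0%N) ?size_iota ?nth_iota; try lia.
  by rewrite add0n; congr (ext L (_, (_, _))); lia.
have -> : reads L (side_NW a c) [seq label_of_bool b | b <- gamma] =
          ([seq ext L (E60, (0, i)) | i <- iota a c] == emb gamma)%N.
  rewrite reads_ext; last first.
    apply: inT => _ /mapP[i + ->]; rewrite mem_iota => /= ic.
    by rewrite mem_cat mem_strips_edges; apply/orP; right; lia.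
  rewrite -[a in iota a c]addn0 iotaDl -!map_comp; congr (_ == _).
have -> : reads L (side_NE a c) [seq label_of_bool b | b <- nu] =
          (inner (a + c) (ext L) == emb nu).
  rewrite reads_ext; last first.
    apply: inT => _ /mapP[i + ->]; rewrite mem_iota => /= ic.
    by rewrite mem_trap_list in120 //; lia.
  by rewrite /inner /side_NE -map_comp.
have -> : reads L (side_S a c) [seq label_of_bool b | b <- delta] =
          ([seq ext L (E0, (i, 0)) | i <- iota a c] == emb (rev delta))%N.
  rewrite reads_ext; last first.
    apply: inT => _ /mapP[i + ->]; rewrite mem_iota => /= ic.
    by rewrite mem_cat mem_strips_edges; apply/orP; right; lia.
  rewrite /emb map_rev -[RHS](inj_eq (can_inj revK)) revK; congr (_ == _).
  apply: (@eq_from_nth _ L0) => [|i]; first by rewrite size_rev !size_map !size_iota.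
  rewrite size_map size_mkseq => ic.
  rewrite nth_rev ?size_map ?size_iota //.
  rewrite (nth_map (E0, (0, 0))%N) ?size_mkseq // nth_mkseq //.
  rewrite (nth_map 0%N) ?size_iota ?nth_iota; try lia.
  by congr (ext L (_, (_, _))); lia.
have -> : all (fun p => all (in_trap a c) (up_corners p) ==> allowed L (up_edges p))
    (grid a c) =
  all (fun i => all (up_ok i (ext L)) (iota 0 i.+1)) (iota a c).
  apply/allP/allP => [ok m | ok [x y] _].
    rewrite mem_iota => mac; apply/allP => j; rewrite mem_iota => jm.
    have := ok (j, m - j)%N; rewrite /= /in_trap /= allowed_ext /= ?in120 ?inS; try lia.
    move=> okj; apply: (implyP (okj _)); last lia.
    by apply/allpairsP; exists (j, m - j)%N; rewrite !mem_iota; split => //=; lia.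
  apply/implyP; rewrite /= /in_trap /= => xy.
  rewrite allowed_ext /= ?in120 ?inS; try lia.
  have : (x + y)%N \in iota a c by rewrite mem_iota; lia.
  move=> /ok /allP /(_ x); rewrite mem_iota /up_ok addKn; apply; lia.
(* The downward triangle at (x, y) lies in strip x + y + 1, unlike the upward one, which lies in
   strip x + y. *)
have -> : all (fun p => all (in_trap a c) (down_corners p) ==> allowed L (down_edges p))
    (grid a c) =
  all (fun i => all (down_ok i (ext L)) (iota 0 i)) (iota a c).
  apply/allP/allP => [ok m | ok [x y] _].
    rewrite mem_iota => mac; apply/allP => j; rewrite mem_iota => jm.
    have := ok (j, m - j.+1)%N; rewrite /= /in_trap /=.
    rewrite allowed_ext /= ?in120 ?inS; try lia.
    rewrite /down_ok -subSn ?subSS; try lia.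
    move=> okj; apply: (implyP (okj _)); last lia.
    by apply/allpairsP; exists (j, m - j.+1)%N; rewrite !mem_iota; split => //=; lia.
  apply/implyP; rewrite /= /in_trap /= => xy.
  rewrite allowed_ext /= ?in120 ?inS; try lia.
  have : (x + y).+1 \in iota a c by rewrite mem_iota; lia.
  move=> /ok /allP /(_ x); rewrite mem_iota /down_ok.
  by rewrite subSS addKn subSn ?leq_addr // addKn; apply; lia.
by do ![case: (_ == _) => //=]; rewrite ?andbF ?andbT.
Qed.
End Bridge.

(** * From [Trap] to Littlewood-Richardson coefficients *)

Lemma Trap_Tr a c (beta : a.-tuple bool) (gamma : c.-tuple bool)
    (nu : (a + c).-tuple bool) (delta : c.-tuple bool) :
  Trap beta gamma nu delta = Tr (rev beta) gamma nu (rev delta).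
Proof.
rewrite -(@sumE_trap_list a _ _ _ _ (fun=> L0)) ?size_rev ?size_tuple //.
rewrite -(@card_ffun_sumE (trap_edges a c)); last 2 first.
- exact: uniq_trap_list.
- exact: mem_trap_list.
by apply: eq_card => L; rewrite !inE is_puzzleE ?size_tuple.
Qed.

Lemma ones_rev s : ones (rev s) = ones s.
Proof. by rewrite /ones count_rev. Qed.

Lemma sum_strings n k (F : seq bool -> int) :
  \sum_(mu in strings n k) F mu = \sum_(w <- words n | ones w == k) F w.
Proof.
have -> : \sum_(w <- words n | ones w == k) F w =
          \sum_(mu : n.-tuple bool | ones mu == k) F mu.
  rewrite -big_filter -(big_map (@tval n bool) (fun w => ones w == k) F).
  rewrite -[RHS]big_filter; apply: perm_big; apply: uniq_perm.
  - by rewrite filter_uniq ?uniq_words.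
  - by rewrite filter_uniq // map_inj_uniq ?index_enum_uniq //; apply: val_inj.
  move=> w; rewrite !mem_filter mem_words; congr (_ && _).
  apply/eqP/mapP => [sw|[x _ ->]]; last by rewrite size_tuple.
  by exists (tcast sw (in_tuple w)); rewrite ?mem_index_enum ?val_tcast.
by apply: eq_bigl => mu; rewrite inE.
Qed.

Theorem proposition6 (a0 a1 c0 c1 : nat)
    (beta : (a0 + a1).-tuple bool)
    (gamma delta : (c0 + c1).-tuple bool)
    (nu : (a0 + a1 + (c0 + c1)).-tuple bool)
    (hbeta : beta \in strings (a0 + a1) a1)
    (hgamma : gamma \in strings (c0 + c1) c1)
    (hdelta : delta \in strings (c0 + c1) c1)
    (hnu : nu \in strings (a0 + a1 + (c0 + c1)) (a1 + c1)) :
  (Trap beta gamma nu delta)%:Z =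
  \sum_(mu in strings (c0 + c1) c1)
    LR_pad (rev beta) mu nu * LR_string gamma mu (rev delta).
Proof.
move: hbeta hgamma hdelta hnu; rewrite !inE => /eqP ob /eqP og /eqP od /eqP on.
have zE n0 n1 w : size w = (n0 + n1)%N -> ones w = n1 -> zeros w = n0.
  by move=> sw ow; have := zerosDones w; lia.
have zb : zeros (rev beta) = a0.
  by apply: (zE a0 a1); rewrite ?size_rev ?size_tuple ?ones_rev.
have zg : zeros gamma = c0 by apply: (zE c0 c1); rewrite ?size_tuple.
have zn : zeros nu = (a0 + c0)%N by apply: (zE _ (a1 + c1)%N); rewrite ?size_tuple; lia.
rewrite Trap_Tr -natz Tr_formula ?size_rev ?size_tuple ?ones_rev ?ob ?og ?od ?on //.
have /= -> := sum_strings (c0 + c1) c1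
  (fun mu => LR_pad (rev beta) mu nu * LR_string gamma mu (rev delta)).
rewrite /formula size_tuple og; rewrite big_seq_cond [RHS]big_seq_cond.
apply: eq_bigr => mu /andP[+ /eqP om]; rewrite mem_words => /eqP smu.
have zm : zeros mu = c0 by apply: (zE _ c1).
(* The padding widths computed from [nu] reduce to c0, c1 for [rev beta] and to a0, a1 for [mu],
   which are those in [formula]. *)
rewrite /LR_pad zn on /pad zb zm ones_rev ob om !addnK !addKn.
rewrite LR_string_tri ?size_cat ?size_nseq ?size_rev ?size_tuple
  ?smu ?ones_cat ?ones_nseq ?ones_rev ?ob ?om ?on ?mul1n ?mul0n; try lia.
rewrite LR_string_tri ?size_rev ?size_tuple ?ones_rev ?og ?od ?om //.
by rewrite zg !natz.
Qed.
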